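(* There is an algorithm that outputs a minimum-weight basis of a matroid on $n$ elements, with unknown element weights $w: U \to \mathbb{R}$, using $O(n \log n)$ comparison queries between bases, in $\widetilde{O}(n^2)$ time.
   Context: The matroid $\mathcal{M} = (U, \mathcal{I})$ has ground set $U$, $|U| = n$; the weight of a basis $S$ is $w(S) = \sum_{e \in S} w_e$. A comparison query takes two bases $S, T$ and reveals whether $w(S) <, =, >$ $w(T)$. *)

(* Defs.v *)
From mathcomp Require Import all_boot all_order all_algebra.
From mathcomp Require Import reals.

Set Implicit Arguments.
Unset Strict Implicit.
Unset Printing Implicit Defensive.

Import Order.TTheory GRing.Theory Num.Theory.

(** * Matroids *)

Record matroid (U : finType) := Matroid {
  indep : pred {set U};
  _ : indep set0;
  _ : forall A B : {set U}, A \subset B -> indep B -> indep A;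
  _ : forall A B : {set U}, indep A -> indep B -> #|A| < #|B| ->
        exists2 x, x \in B :\: A & indep (x |: A) }.

Definition basis (U : finType) (M : matroid U) (S : {set U}) : bool :=
  maxset (indep M) S.

Definition weight (R : realType) (U : finType) (w : U -> R) (S : {set U}) : R :=
  (\sum_(e in S) w e)%R.

Definition min_weight_basis (R : realType) (U : finType) (M : matroid U)
    (w : U -> R) (S : {set U}) : Prop :=
  basis M S /\ (forall T, basis M T -> (weight w S <= weight w T)%R).

(** * Oracles *)

(* The answer [None] means that the query is not allowed. *)
Definition compare_bases (R : realType) (U : finType) (M : matroid U)
    (w : U -> R) (S T : {set U}) : option comparison :=
  if basis M S && basis M T then
    Some (if (weight w S < weight w T)%R then Lt
          else if (weight w S == weight w T)%R then Eq else Gt)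
  else None.

(** * Random access machines with oracles *)

(* The machine model is a random access machine programmed in a structured
   language.  A program uses finitely many registers, each holding a natural
   number, and finitely many zero-initialised arrays of natural numbers with
   indirect access.  Registers and arrays are named by natural numbers. *)

Inductive binop := OpAdd | OpSub | OpMul | OpDiv | OpLeq | OpEq.

Inductive expr :=
  | Const of nat
  | Reg of nat
  | Get of nat & expr
  | Bin of binop & expr & expr.

(* [Indep x a] asks the independence oracle about the set stored in array [a];
   [Compare x a b] asks the comparison oracle about the sets stored in arrays
   [a] and [b].  The answer goes to register [x]. *)
Inductive prog :=
  | Skip
  | Assign of nat & expr
  | Put of nat & expr & expr
  | Seq of prog & prog
  | If of expr & prog & prog
  | While of expr & prog
  | Indep of nat & nat
  | Compare of nat & nat & nat.

Record state := State { regs : nat -> nat; arrs : nat -> nat -> nat }.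

Definition set_reg (s : state) (x v : nat) : state :=
  State (fun y => if y == x then v else regs s y) (arrs s).

Definition set_arr (s : state) (a i v : nat) : state :=
  State (regs s)
    (fun b j => if (b == a) && (j == i) then v else arrs s b j).

(* An array stores a subset of the ground set by its characteristic vector. *)
Definition arr_set (n : nat) (s : state) (a : nat) : {set 'I_n} :=
  [set i : 'I_n | arrs s a i != 0].

Definition binop_eval (o : binop) (u v : nat) : nat :=
  match o with
  | OpAdd => u + v
  | OpSub => u - v
  | OpMul => u * v
  | OpDiv => u %/ v
  | OpLeq => u <= v
  | OpEq => u == v
  end.

Fixpoint eval (s : state) (e : expr) : nat :=
  match e with
  | Const c => c
  | Reg x => regs s x
  | Get a e1 => arrs s a (eval s e1)
  | Bin o e1 e2 => binop_eval o (eval s e1) (eval s e2)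
  end.

(* Number of binary digits, with [bits 0 = 1]. *)
Definition bits (m : nat) : nat := (trunc_log 2 m).+1.

(* Logarithmic cost: evaluating an expression costs the total bit length of
   the values (addresses included) occurring in the evaluation, so that no work
   can be hidden in operations on large numbers. *)
Fixpoint cost (s : state) (e : expr) : nat :=
  bits (eval s e) +
  match e with
  | Const _ | Reg _ => 0
  | Get _ e1 => cost s e1
  | Bin _ e1 e2 => cost s e1 + cost s e2
  end.

Definition comparison_code (c : comparison) : nat :=
  match c with Lt => 0 | Eq => 1 | Gt => 2 end.

(* [exec ind cmp p s s' q t]: started in state [s], the program [p] halts in
   state [s'] after [q] comparison queries and [t] units of time, never having
   asked a comparison query that is not allowed.  An oracle call takes one unit
   of time; writing the queried sets into the arrays is paid for by the program.
   The oracles are the only access of [p] to the matroid and to the weights. *)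
Inductive exec (n : nat) (ind : pred {set 'I_n})
    (cmp : {set 'I_n} -> {set 'I_n} -> option comparison) :
    prog -> state -> state -> nat -> nat -> Prop :=
  | ExecSkip s :
      exec ind cmp Skip s s 0 1
  | ExecAssign s x e :
      exec ind cmp (Assign x e) s (set_reg s x (eval s e)) 0 (1 + cost s e)
  | ExecPut s a e1 e2 :
      exec ind cmp (Put a e1 e2) s (set_arr s a (eval s e1) (eval s e2))
        0 (1 + cost s e1 + cost s e2)
  | ExecSeq p1 p2 s s1 s2 q1 q2 t1 t2 :
      exec ind cmp p1 s s1 q1 t1 -> exec ind cmp p2 s1 s2 q2 t2 ->
      exec ind cmp (Seq p1 p2) s s2 (q1 + q2) (t1 + t2)
  | ExecIf e p1 p2 s s1 q t :
      exec ind cmp (if eval s e != 0 then p1 else p2) s s1 q t ->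
      exec ind cmp (If e p1 p2) s s1 q (1 + cost s e + t)
  | ExecWhileStop e p s :
      eval s e = 0 ->
      exec ind cmp (While e p) s s 0 (1 + cost s e)
  | ExecWhileStep e p s s1 s2 q1 q2 t1 t2 :
      eval s e <> 0 ->
      exec ind cmp p s s1 q1 t1 -> exec ind cmp (While e p) s1 s2 q2 t2 ->
      exec ind cmp (While e p) s s2 (q1 + q2) (1 + cost s e + t1 + t2)
  | ExecIndep s x a :
      exec ind cmp (Indep x a) s (set_reg s x (ind (arr_set n s a))) 0 1
  | ExecCompare s x a b c :
      cmp (arr_set n s a) (arr_set n s b) = Some c ->
      exec ind cmp (Compare x a b) s (set_reg s x (comparison_code c)) 1 1.

(* The input is the size of the ground set, in register 0; the output is the
   set stored in array 0. *)
Definition init_state (n : nat) : state :=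
  State (fun x => if x == 0 then n else 0) (fun _ _ => 0).

Definition outputs (R : realType) (p : prog) (n : nat) (M : matroid 'I_n)
    (w : 'I_n -> R) (S : {set 'I_n}) (q t : nat) : Prop :=
  exists2 s, exec (indep M) (compare_bases M w) p (init_state n) s q t
           & S = arr_set n s 0.

(** * Asymptotics *)

Definition bigO (f g : nat -> nat) : Prop :=
  exists C n0 : nat, forall n, n0 <= n -> f n <= C * g n.

(* [trunc_log 2 n] is the integer part of the binary logarithm of [n]. *)
Definition soft_bigO (f g : nat -> nat) : Prop :=
  exists k : nat, bigO f (fun n => g n * trunc_log 2 n ^ k).

(* Main.v *)
Require Import Defs.
From mathcomp Require Import all_boot all_order all_algebra.
From mathcomp Require Import reals.
From mathcomp Require Import zify.

(** Fix a basis [B].  Its fundamental graph joins two elements [x], [y], exactly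
one of them in [B], when exchanging them in [B] gives a basis again.  Its
connected components are separators of the matroid, so only elements of the
same component can be exchanged, in any basis; hence the greedy algorithm is
correct as soon as the elements of each component are processed by increasing
weight.

Two elements [a], [b] of one component can be compared with a single query.
Along an induced path from [a] to [b] in the fundamental graph, toggle the
inner vertices in [B]; the result with [a] put in and [b] out, and the result
with [b] put in and [a] out, are both bases, and their weights differ by
[w a - w b].

Number the elements in the order of a breadth first search, and let [pp k] be
the position of the parent of [k], that is, of its least neighbour.  Starting
from [a] and [b], replace the larger of the two current vertices by its parent
until they are adjacent: since [pp] is monotone, this yields an induced path,
in linear time.  Binary insertion sort then uses O(n log n) comparisons. *)

Set Implicit Arguments.
Unset Strict Implicit.
Unset Printing Implicit Defensive.

Import Order.TTheory GRing.Theory Num.Theory.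

(** * Exchanges in matroids *)

Section Matroid.
Variables (U : finType) (M : matroid U).
Implicit Types (A B C D J K S T Z : {set U}) (x y z : U).

Lemma indep0 : indep M set0.
Proof. by case: M. Qed.

Lemma indepS A B : A \subset B -> indep M B -> indep M A.
Proof. by case: M => ind H1 H2 H3 /=; apply: H2. Qed.

Lemma indep_aug A B : indep M A -> indep M B -> #|A| < #|B| ->
  exists2 x, x \in B :\: A & indep M (x |: A).
Proof. by case: M => ind H1 H2 H3 /=; apply: H3. Qed.

(** Iterates [indep_aug], by induction on the difference of the sizes. *)
Lemma indep_extend A C : indep M A -> indep M C -> #|A| <= #|C| ->
  exists J : {set U}, [/\ A \subset J, J \subset A :|: C, #|J| = #|C| & indep M J].
Proof.
move=> + iC; have [k] := ubnP (#|C| - #|A|); elim: k A => // k IH A ltk iA.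
rewrite leq_eqVlt => /orP[/eqP eqAC|ltAC].
  by exists A; rewrite subsetUl.
have [x /setDP[xC xNA] ixA] := indep_aug iA iC ltAC.
have cxA : #|x |: A| = #|A|.+1 by rewrite cardsU1 xNA.
have [||J [sJ sJ' cJ iJ]] := IH (x |: A) _ ixA.
- by rewrite cxA; apply: (@leq_trans (#|C| - #|A|)) => //; rewrite ltn_sub2l.
- by rewrite cxA.
exists J; split=> //; first exact: subset_trans (subsetUr _ _) sJ.
apply: subset_trans sJ' _; rewrite -setUA subUset sub1set inE xC orbT /=.
exact: subxx.
Qed.

Lemma basis_indep B : basis M B -> indep M B.
Proof. by case/maxsetP. Qed.

Lemma basis_max B A : basis M B -> indep M A -> #|A| <= #|B|.
Proof.
case/maxsetP=> iB maxB iA; rewrite leqNgt; apply/negP=> ltBA.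
have [x /setDP[_ xNB] ixB] := indep_aug iB iA ltBA.
by have /setP/(_ x) := maxB _ ixB (subsetUr _ _); rewrite !inE eqxx (negPf xNB).
Qed.

Lemma basisE B A : basis M B -> basis M A = indep M A && (#|A| == #|B|).
Proof.
move=> bB; apply/idP/andP => [bA|[iA /eqP cA]].
  by rewrite eqn_leq !basis_max ?basis_indep.
apply/maxsetP; split=> // C iC sAC; apply/eqP; rewrite eq_sym eqEcard sAC cA.
exact: basis_max.
Qed.

Lemma cards_swap S x y : y \in S -> x \notin S -> #|x |: S :\ y| = #|S|.
Proof.
by move=> yS xNS; rewrite cardsU1 (cardsD1 y S) yS !inE (negPf xNS) andbF.
Qed.

Lemma basis_swap B D x y : basis M B -> y \in B -> x \notin B ->
  basis M (x |: B :\ y) = indep M (x |: B :\ y).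
Proof. by move=> bB yB xB; rewrite (basisE _ bB) cards_swap // eqxx andbT. Qed.

(** Augment [x |: A] from [S] to an independent [J] of size [#|S|]. Since [J] contains [x] and lies
    in [x |: S], it misses exactly one element of [S]; this is [z], and [A \subset J] keeps it out
    of [A]. *)
Lemma indep_swap_out S A x : indep M S -> A \subset S -> x \notin S ->
  indep M (x |: A) -> A != S ->
  exists2 z, z \in S :\: A & indep M (x |: S :\ z).
Proof.
move=> iS sAS xNS ixA nAS.
have pA : A \proper S by rewrite properEneq nAS.
have xNA : x \notin A by apply: contra xNS; apply: (subsetP sAS).
have cle : #|x |: A| <= #|S| by rewrite cardsU1 xNA; exact: proper_card.
have [J [sJ sJ' cJ iJ]] := indep_extend ixA iS cle.
have xJ : x \in J by apply: (subsetP sJ); rewrite !inE eqxx.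
have sJx : J \subset x |: S.
  apply: subset_trans sJ' _; rewrite -setUA; apply: setUS.
  by rewrite subUset sAS subxx.
have : ~~ (S \subset J).
  apply/negP=> sSJ; have /eqP eqSJ : S == J by rewrite eqEcard sSJ cJ /=.
  by rewrite -eqSJ (negPf xNS) in xJ.
case/subsetPn=> z zS zNJ; exists z.
  rewrite inE zS andbT; apply: contra zNJ => zA; apply: (subsetP sJ).
  by rewrite inE zA orbT.
have -> : x |: S :\ z = J; last by [].
apply/eqP; rewrite eq_sym eqEcard cards_swap // cJ leqnn andbT.
apply/subsetP=> u uJ; rewrite !inE.
have /setU1P[->|uS] := subsetP sJx u uJ; first by rewrite eqxx.
by rewrite uS andbT orbC; have [uz|] := eqVneq u z; first by rewrite -uz uJ in zNJ.
Qed.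

(** * The fundamental graph of a basis *)

Definition toggle S x := if x \in S then S :\ x else x |: S.

Lemma in_toggle S x y : (y \in toggle S x) = (y \in S) (+) (y == x).
Proof.
rewrite /toggle; case: ifP => xS; rewrite !inE.
  by have [->|] := eqVneq y x; rewrite ?xS ?addbF.
by have [->|] := eqVneq y x; rewrite ?xS ?addbF.
Qed.

(** Stated with [toggle], the relation is visibly symmetric and does not depend on which of the two
    elements lies in [B]. *)
Definition xadj B x y := ((x \in B) != (y \in B)) && indep M (toggle (toggle B x) y).

Lemma xadjC B x y : xadj B x y = xadj B y x.
Proof.
rewrite /xadj eq_sym; congr (_ && indep M _).
by apply/setP=> z; rewrite !in_toggle -!addbA [(_ == x) (+) _]addbC.
Qed.

Lemma xadjE B x y : y \in B -> x \notin B -> xadj B x y = indep M (x |: B :\ y).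
Proof.
move=> yB xB; rewrite /xadj yB (negPf xB) /=; congr (indep M _).
apply/setP=> z; rewrite !in_toggle !inE.
have [->|zx] := eqVneq z x; first by rewrite (negPf xB); have [xy|] := eqVneq x y; rewrite // xy yB in xB.
by have [->|zy] := eqVneq z y; rewrite ?yB ?addbF.
Qed.

Lemma xadjxx B x : xadj B x x = false.
Proof. by rewrite /xadj eqxx. Qed.

(* The elements of [B] adjacent to [x], together with [x], form its
   fundamental circuit. *)
Lemma fund_circuit_dep B x : basis M B -> x \notin B ->
  ~~ indep M (x |: [set z in B | xadj B x z]).
Proof.
move=> bB xB; apply/negP=> ixZ.
set Z := [set z in B | _] in ixZ.
have sZ : Z \subset B by apply/subsetP=> z; rewrite inE => /andP[].
have [eqZ|nZ] := eqVneq Z B.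
  by have := basis_max bB ixZ; rewrite eqZ cardsU1 xB ltnn.
have [z /setDP[zB]] := indep_swap_out (basis_indep bB) sZ xB ixZ nZ.
by rewrite inE zB xadjE // => /negP.
Qed.

(** The last hypothesis puts the fundamental circuit of [x] with respect to [B] inside [x |: D]. It
    is therefore also the circuit of [x] with respect to [D], and deleting its element [y] breaks
    it. *)
Lemma exchange_in B D x y : basis M B -> basis M D ->
  y \in B -> y \in D -> x \notin B -> x \notin D -> xadj B x y ->
  (forall z, z \in B -> z \notin D -> ~~ xadj B x z) ->
  basis M (x |: D :\ y).
Proof.
move=> bB bD yB yD xB xD axy sep; rewrite (basis_swap D) //.
set Z := [set z in B | xadj B x z].
have dZ : ~~ indep M (x |: Z) by exact: fund_circuit_dep.
have sZD : Z \subset D.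
  by apply/subsetP=> z; rewrite inE => /andP[zB]; apply: contraLR; apply: sep.
have yZ : y \in Z by rewrite inE yB.
have iZy : indep M (x |: Z :\ y).
  apply: indepS (_ : indep M (x |: B :\ y)); last by rewrite -xadjE.
  by apply/setUS/setSD/subsetP=> z; rewrite inE => /andP[].
have sZyD : Z :\ y \subset D by apply: subset_trans (subsetDl _ _) sZD.
have nZyD : Z :\ y != D by apply/eqP=> /setP/(_ y); rewrite yD !inE eqxx.
have [z /setDP[zD zZ] iz] := indep_swap_out (basis_indep bD) sZyD xD iZy nZyD.
(* If [z] were not [y], the whole dependent set [x |: Z] would survive in the independent set
   [x |: D :\ z]. *)
have [<-//|zy] := eqVneq z y; case/negP: dZ; apply: indepS iz.
apply/setUS/subsetP=> u uZ; rewrite !inE (subsetP sZD u uZ) andbT.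
by apply: contraNneq zZ => uz; rewrite in_setD1 zy -uz uZ.
Qed.

(** The dual of [exchange_in]: here the fundamental cocircuit of [y] with respect to [B] meets [D]
    in [y] only. Instead of passing to the dual matroid, two augmentations are used: if [D :\ y] is
    not augmented by [x], it is by some [u] of [B], and augmenting [B :\ y] back from [u |: D :\ y]
    yields a forbidden neighbour of [y]. *)
Lemma exchange_out B D x y : basis M B -> basis M D ->
  y \in B -> y \in D -> x \notin B -> x \notin D -> xadj B x y ->
  (forall z, z \in D -> z \notin B -> ~~ xadj B z y) ->
  basis M (x |: D :\ y).
Proof.
move=> bB bD yB yD xB xD axy sep; rewrite (basis_swap D) //.
have cDB : #|D :\ y| = #|B :\ y|.
  have := basisE D bB; rewrite bD => /esym/andP[_ /eqP cD].
  by move: cD; rewrite (cardsD1 y D) (cardsD1 y B) yD yB => -[].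
have iDy : indep M (D :\ y) by apply: indepS (subsetDl _ _) (basis_indep bD).
have iBy : indep M (B :\ y) by apply: indepS (subsetDl _ _) (basis_indep bB).
have iBx : indep M (x |: B :\ y) by rewrite -xadjE.
have [|u /setDP[uBx uDy] iu] := indep_aug iDy iBx.
  by rewrite cDB [#|_ |: _|]cardsU1 !inE (negPf xB) andbF.
have /setU1P[<-//|uBy] := uBx.
have [|v /setDP[vDu vBy] iv] := indep_aug iBy iu.
  by rewrite cardsU1 uDy cDB.
have vNu : v != u by apply: contraNneq vBy => ->.
move: vDu vBy; rewrite !inE (negPf vNu) /= => /andP[vy vD]; rewrite vy /= => vB.
by case/negP: (sep v vD vB); rewrite xadjE.
Qed.

(** [B :&: K] spans [K]: for [x] in [K] outside [B], the fundamental circuit stays inside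
    [x |: (B :&: K)], so no such [x] can augment [B :&: K]. *)
Lemma closed_card B K A : basis M B ->
  (forall x y, x \in K -> xadj B x y -> y \in K) ->
  A \subset K -> indep M A -> #|A| <= #|B :&: K|.
Proof.
move=> bB clK sAK iA; rewrite leqNgt; apply/negP=> ltA.
have iBK : indep M (B :&: K) by apply: indepS (subsetIl _ _) (basis_indep bB).
have [x /setDP[xA xBK] ix] := indep_aug iBK iA ltA.
have xK := subsetP sAK x xA.
have xB : x \notin B by move: xBK; rewrite inE xK andbT.
have /negP[] := fund_circuit_dep bB xB; apply: indepS ix.
by apply/setUS/subsetP=> z; rewrite !inE => /andP[-> /(clK _ _ xK)].
Qed.

(** By symmetry of adjacency the complement of [K] is closed too, so [closed_card] bounds both
    sides. Bringing in [x] from [K] for [y] outside [K] would give [#|S| < #|B|]. *)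
Lemma exchange_closed B K S x y : basis M B ->
  (forall u v, u \in K -> xadj B u v -> v \in K) ->
  basis M S -> y \in S -> x \notin S -> indep M (x |: S :\ y) ->
  x \in K -> y \in K.
Proof.
move=> bB clK bS yS xS ixy xK; apply: contraT => yK.
have clK' u v : u \in ~: K -> xadj B u v -> v \in ~: K.
  by rewrite !inE xadjC => uK auv; apply: contra uK => /clK; apply.
have cBS : #|S| = #|B| by apply/eqP; have := basisE S bB; rewrite bS => /esym/andP[].
have leK : #|(x |: S :\ y) :&: K| <= #|B :&: K|.
  by apply: closed_card => //; [exact: subsetIr | exact: indepS (subsetIl _ _) ixy].
have leK' : #|S :&: ~: K| <= #|B :&: ~: K|.
  by apply: closed_card => //; [exact: subsetIr | exact: indepS (subsetIl _ _) (basis_indep bS)].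
have eK : (x |: S :\ y) :&: K = x |: (S :&: K).
  apply/setP=> u; rewrite !inE; have [->|_] := eqVneq u x; rewrite ?xK //=.
  by have [->|_] := eqVneq u y; rewrite ?(negPf yK) ?andbF.
have cK : #|(x |: S :\ y) :&: K| = #|S :&: K|.+1.
  by rewrite eK cardsU1 inE (negPf xS).
rewrite -!setDE in leK'.
have := cBS; rewrite -(cardsID K S) -(cardsID K B) => /eqP.
by rewrite ltn_eqF // -addSn leq_add // -cK.
Qed.

(** Symmetric basis exchange. [Z], the fundamental circuit of [x] without [x], spans [x]; as
    [T :\ x] does not, some element of [Z] must augment [T :\ x]. *)
Lemma sym_exchange S T x : basis M S -> basis M T -> x \in T -> x \notin S ->
  exists y, [/\ y \in S, y \notin T, indep M (x |: S :\ y) & indep M (y |: T :\ x)].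
Proof.
move=> bS bT xT xS; set Z := [set z in S | xadj S x z].
have iZ : indep M Z.
  by apply: indepS (basis_indep bS); apply/subsetP=> z; rewrite inE => /andP[].
have iA : indep M (T :\ x) by apply: indepS (subsetDl _ _) (basis_indep bT).
suff [y yZ [yA iy]] : exists2 y, y \in Z & y \notin T :\ x /\ indep M (y |: T :\ x).
  move: yZ; rewrite inE => /andP[yS]; rewrite xadjE // => iy'.
  exists y; split=> //; move: yA; rewrite !inE.
  by have [yx|] := eqVneq y x; first by rewrite -yx yS in xS.
have [leZ|ltA] := leqP #|Z| #|T :\ x|; last first.
  by have [y /setDP[yZ yA] iy] := indep_aug iA iZ ltA; exists y.
have [J [sJ sJ' cJ iJ]] := indep_extend iZ iA leZ.
have [|u /setDP[uT uJ] iu] := indep_aug iJ (basis_indep bT).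
  by rewrite cJ [ltnRHS](cardsD1 x) xT.
(* [u] cannot be [x], because [J] contains [Z] and [x |: Z] is dependent. Hence [u] is in [T :\ x],
   and the next augmentation must pick an element of [J] outside [T :\ x], that is, of [Z]. *)
have [ux|ux] := eqVneq u x.
  have /negP[] := fund_circuit_dep bS xS; apply: indepS iu.
  by rewrite ux; apply: setUS.
have [|v /setDP[vuJ vA] iv] := indep_aug iA iu.
  by rewrite cardsU1 uJ cJ.
exists v => //; have : v \in Z :|: T :\ x.
  move: vuJ; rewrite in_setU1 => /orP[/eqP vu|/(subsetP sJ')//].
  by move: vA; rewrite !inE vu ux uT.
by rewrite inE (negPf vA) orbF.
Qed.

(** * Local optimality implies minimality *)

Variables (R : realType) (w : U -> R).
Local Open Scope ring_scope.

Lemma weight_swap S x y : y \in S -> x \notin S ->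
  weight w (x |: S :\ y) + w y = weight w S + w x.
Proof.
move=> yS xS; rewrite /weight big_setU1; last by rewrite !inE (negPf xS) andbF.
by rewrite (big_setD1 y yS) /= [w x + _]addrC addrAC [w y + _]addrC.
Qed.

(** Induction on [#|T :\: S|]: a symmetric exchange moves [T] one element closer to [S], and
    optimality of [S] against the same pair shows that [T] gets no heavier. *)
Lemma local_opt_min S : basis M S ->
  (forall x y, x \notin S -> y \in S -> indep M (x |: S :\ y) -> w y <= w x) ->
  min_weight_basis M w S.
Proof.
move=> bS opt; split=> // T; have [k] := ubnP #|T :\: S|.
elim: k T => // k IH T ltk bT.
have [sTS|/subsetPn[x xT xS]] := boolP (T \subset S).
  suff -> : T = S by [].
  apply/eqP; rewrite eqEcard sTS; exact: basis_max (basis_indep bS).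
have [y [yS yT i1 i2]] := sym_exchange bS bT xT xS.
have bT' : basis M (y |: T :\ x) by rewrite basis_swap.
have le' := IH _ _ bT'; apply: le_trans (le' _) _.
  move: ltk; rewrite (cardsD1 x (T :\: S)) inE xS xT /= => /ltnSE; apply: leq_trans.
  rewrite ltnS; apply/subset_leq_card/subsetP=> z; rewrite !inE.
  have [->|_] := eqVneq z y; first by rewrite yS.
  by case: (z == x); rewrite ?andbF.
rewrite -(lerD2r (w x)) weight_swap // lerD2l; exact: opt.
Qed.

End Matroid.
Arguments toggle {U} S x.

(** * Exchanges along paths, and the greedy algorithm *)

Section Exchange.
Variables (U : finType) (M : matroid U).
Implicit Types (B S : {set U}) (a b x y : U).

Definition toggles B s := foldl toggle B s.

Lemma in_toggles B s x : uniq s -> (x \in toggles B s) = (x \in B) (+) (x \in s).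
Proof.
elim: s B => [|y s IH] B /=; first by rewrite addbF.
case/andP=> ys us; rewrite IH // in_toggle in_cons -addbA; congr (_ (+) _).
by have [->|//] := eqVneq x y; rewrite (negPf ys).
Qed.

(** Forces [a] in and [b] out whatever their status in [S], so [put_swap S a b] and [put_swap S b a]
    differ only in [a] and [b]. *)
Definition put_swap S a b := a |: S :\ b.

Lemma in_put_swap S a b x : (x \in put_swap S a b) = (x == a) || (x != b) && (x \in S).
Proof. by rewrite !inE. Qed.

(** Prolongs an induced path by one vertex: [a'] is the old end, [s] the old inner vertices, [a] the
    new end. One new set equals an old one; the other arises from the other old one by exchanging
    [a] and [a'], which is legal because [a] has no neighbour in [s] and is not adjacent to [b]. *)
Lemma path_exchange B a a' b s : basis M B -> uniq (a' :: s) ->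
    a != b -> a' != b -> a != a' -> a \notin s -> b \notin s ->
    xadj M B a a' -> ~~ xadj M B a b -> (forall z, z \in s -> ~~ xadj M B a z) ->
    basis M (put_swap (toggles B s) a' b) -> basis M (put_swap (toggles B s) b a') ->
  basis M (put_swap (toggles B (a' :: s)) a b) /\
  basis M (put_swap (toggles B (a' :: s)) b a).
Proof.
move=> bB us nab na'b naa' as_ bs adj nadj nadjs b1 b2.
have /= /andP[a's us'] := us.
pose E := (in_put_swap, in_toggles _ _ us, in_toggles _ _ us', in_cons).
case: (boolP (a \in B)) (boolP (a' \in B)) => aB [] a'B;
  try by move: adj; rewrite /xadj ?aB ?a'B ?(negPf aB) ?(negPf a'B).
(* Here [a] is in [B] and [a'] is not, so [a] leaves: [exchange_out] applies, since the elements
   gained relative to [B] lie in [s] or equal [b]. *)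
- have e1 : put_swap (toggles B (a' :: s)) a b = put_swap (toggles B s) a' b.
    apply/setP=> x; rewrite !E.
    have [->|xa] := eqVneq x a; first by rewrite nab aB (negPf as_) (negPf naa').
    by have [->|//] := eqVneq x a'; rewrite na'b (negPf a'B).
  have e2 : put_swap (toggles B (a' :: s)) b a = a' |: put_swap (toggles B s) b a' :\ a.
    apply/setP=> x; rewrite in_setU1 in_setD1 !E.
    have [->|xa'] := eqVneq x a'.
      by rewrite (negPf na'b) eq_sym naa' (negPf a'B) (negPf a's).
    by have [->|//] := eqVneq x a; rewrite (negPf nab).
  rewrite e1 e2; split=> //; apply: (exchange_out bB b2) => //.
  - by rewrite !E aB (negPf as_) naa' orbT.
  - by rewrite !E (negPf na'b) eqxx.
  - by rewrite xadjC.
  move=> z; rewrite !E xadjC; have [->//|_] := eqVneq z b.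
  by have [/nadjs//|_] := boolP (z \in s); rewrite addbF => /andP[_ ->].
(* Here [a] enters: [exchange_in] applies, since the elements of [B] lost are [b] or in [s]. *)
- have e1 : put_swap (toggles B (a' :: s)) b a = put_swap (toggles B s) b a'.
    apply/setP=> x; rewrite !E.
    have [->|xa] := eqVneq x a.
      by rewrite (negPf nab) (negPf naa') (negPf aB) (negPf as_).
    by have [->|//] := eqVneq x a'; rewrite (negPf na'b) a'B.
  have e2 : put_swap (toggles B (a' :: s)) a b = a |: put_swap (toggles B s) a' b :\ a'.
    apply/setP=> x; rewrite in_setU1 in_setD1 !E.
    have [->//|xa] := eqVneq x a.
    by have [->|xa'] := eqVneq x a'; rewrite ?a'B ?andbF.
  rewrite e1 e2; split=> //; apply: (exchange_in bB b1) => //.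
  - by rewrite !E eqxx.
  - by rewrite !E (negPf naa') (negPf aB) (negPf as_) andbF.
  move=> z zB; rewrite !E zB; have [//|_] := eqVneq z a'.
  have [->//|_] := eqVneq z b.
  by have [/nadjs//|_] := boolP (z \in s).
Qed.

Section Weights.
Variables (R : realType) (w : U -> R).
Local Open Scope ring_scope.

Lemma weight_put_swap S a b : a != b ->
  weight w (put_swap S a b) = w a + weight w (S :\ a :\ b).
Proof.
move=> nab; rewrite /weight /put_swap (big_setD1 a) ?setU11 //=; congr (_ + _).
by apply: eq_bigl => x; rewrite !inE; case: eqVneq => //= _; rewrite ?andbF.
Qed.

Lemma compare_put_swap S a b : a != b ->
  basis M (put_swap S a b) -> basis M (put_swap S b a) ->
  compare_bases M w (put_swap S a b) (put_swap S b a) =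
    Some (if w a < w b then Lt else if w a == w b then Eq else Gt).
Proof.
move=> nab b1 b2; rewrite /compare_bases b1 b2 /= !weight_put_swap //; last by rewrite eq_sym.
have -> : S :\ b :\ a = S :\ a :\ b by apply/setP=> x; rewrite !inE andbCA.
set r := weight w _; have -> : (w a + r == w b + r) = (w a == w b).
  by apply/eqP/eqP=> [/addIr|->].
by rewrite ltrD2r.
Qed.

End Weights.

(* Vertices are represented by their positions in the queue; a root is its own
   parent and labels its component. *)
Record bfs_tree n (adj : rel nat) (pp cp : nat -> nat) : Prop := BfsTree {
  pp_le : forall k, k < n -> pp k <= k;
  pp_mono : forall i k, i <= k -> k < n -> pp i <= pp k;
  pp_adj : forall k, k < n -> pp k < k -> adj (pp k) k;
  pp_min : forall i k, k < n -> i < pp k -> ~~ adj i k;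
  cp_le : forall k, k < n -> cp k <= k;
  cp_root : forall k, k < n -> pp k = k -> cp k = k;
  cp_const : forall i k, k < n -> pp k <= i <= k -> cp i = cp k }.

(** The list holds the inner vertices of the path in the order in which climbing reaches them,
    mixing the two ends. *)
Inductive walk (adj : rel nat) (pp : nat -> nat) : nat -> nat -> seq nat -> Prop :=
  | WalkStop u v : adj u v -> walk adj pp u v [::]
  | WalkLeft u v p : ~~ adj u v -> v < u -> walk adj pp (pp u) v p ->
      walk adj pp u v (pp u :: p)
  | WalkRight u v p : ~~ adj u v -> u < v -> walk adj pp u (pp v) p ->
      walk adj pp u v (pp v :: p).

Definition pos_adj B (qf : nat -> U) : rel nat := fun i j => xadj M B (qf i) (qf j).

(** * Walks climbing in the search tree are induced paths *)

Section Walk.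
Variables (n : nat) (B : {set U}) (qf : nat -> U) (pp cp : nat -> nat).
Notation adj := (pos_adj B qf).
Hypothesis bB : basis M B.
Hypothesis qf_inj : {in gtn n &, injective qf}.
Hypothesis tree : bfs_tree n adj pp cp.

Lemma adjC i j : adj i j = adj j i.
Proof. exact: xadjC. Qed.

Lemma adj_neq i j : adj i j -> i != j.
Proof. by apply: contraTneq => ->; rewrite /pos_adj xadjxx. Qed.

(** For [i <= j], a neighbour [i] of [j] is at least its least neighbour [pp j], and labels are
    constant from [pp j] to [j]. *)
Lemma adj_cp i j : i < n -> j < n -> adj i j -> cp i = cp j.
Proof.
wlog ij : i j / i <= j.
  by move=> H; case/orP: (leq_total i j) => ij *; [|symmetry]; apply: H => //; rewrite adjC.
move=> _ jn aij; apply: (cp_const tree jn); rewrite ij andbT.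
by rewrite leqNgt; apply/negP=> /(pp_min tree jn)/negP.
Qed.

(** A root [u] has label [u], whereas the label of [v] is at most [v], which is smaller. *)
Lemma pp_lt u v : u < n -> v < u -> cp u = cp v -> pp u < u.
Proof.
move=> un vu e; rewrite ltn_neqAle (pp_le tree un) andbT.
apply/eqP=> /(cp_root tree un) cu; have := cp_le tree (ltn_trans vu un).
by rewrite -e cu leqNgt vu.
Qed.

Lemma cp_pp u : u < n -> cp (pp u) = cp u.
Proof. by move=> un; apply: (cp_const tree un); rewrite leqnn (pp_le tree un). Qed.

Lemma walk_sym u v p : walk adj pp u v p -> walk adj pp v u p.
Proof.
elim=> {u v p} [u v auv|u v p nadj vu _ wk|u v p nadj uv _ wk].
- by apply: WalkStop; rewrite adjC.
- by apply: WalkRight => //; rewrite adjC.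
by apply: WalkLeft => //; rewrite adjC.
Qed.

(** Each step replaces the larger end, and by monotonicity of [pp] every vertex reached later is at
    most the parent just taken. This bound is the invariant that makes the vertices distinct. *)
Lemma walk_range u v p : walk adj pp u v p -> u < n -> v < n -> cp u = cp v ->
  [/\ u \notin p, v \notin p, uniq p, u != v &
      forall k, k \in p -> k <= pp (maxn u v)].
Proof.
have step u' v' (p' : seq nat) : ~~ adj u' v' -> v' < u' -> u' < n -> v' < n ->
    cp u' = cp v' ->
    [/\ pp u' \notin p', v' \notin p', uniq p', pp u' != v' &
      forall k, k \in p' -> k <= pp (maxn (pp u') v')] ->
    [/\ u' \notin pp u' :: p', v' \notin pp u' :: p', uniq (pp u' :: p'), u' != v' &
      forall k, k \in pp u' :: p' -> k <= pp (maxn u' v')].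
  move=> nadj vu un vn ec [h1 h2 h3 h4 h5].
  have lt := pp_lt un vu ec.
  have le k : k \in p' -> k <= pp u'.
    move=> /h5 kle; apply: leq_trans kle _; apply: (pp_mono tree _ un).
    by rewrite geq_max (ltnW lt) ltnW.
  rewrite (maxn_idPl (ltnW vu)) /= !inE h3 h1 (negPf h2) orbF [v' == _]eq_sym h4.
  rewrite [u' == v']eq_sym (ltn_eqF vu) [u' == _]eq_sym (ltn_eqF lt) /=; split=> //.
    by apply/negP=> /le; rewrite leqNgt lt.
  by move=> k /orP[/eqP->//|/le].
elim=> {u v p} [u v auv|u v p nadj vu _ IH|u v p nadj uv _ IH] un vn ec.
- by split=> //; apply: adj_neq.
- apply: step => //; apply: IH => //; last by rewrite cp_pp.
  exact: leq_ltn_trans (pp_le tree un) un.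
have pvn : pp v < n := leq_ltn_trans (pp_le tree vn) vn.
have [||h1 h2 h3 h4 h5] := step v u p _ uv vn un (esym ec).
- by rewrite adjC.
- have [|h1 h2 h3 h4 h5] := IH un pvn; first by rewrite cp_pp.
  by split=> //; [rewrite eq_sym | move=> k; rewrite maxnC; apply: h5].
by split=> //; [rewrite eq_sym | move=> k; rewrite maxnC; apply: h5].
Qed.

(** Induction along the walk with [path_exchange]. Right steps reduce to left steps by [walk_sym],
    which keeps the list of inner vertices. *)
Lemma walk_bases u v p : walk adj pp u v p -> u < n -> v < n -> cp u = cp v ->
  basis M (put_swap (toggles B (map qf p)) (qf u) (qf v)) /\
  basis M (put_swap (toggles B (map qf p)) (qf v) (qf u)).
Proof.
have step u' v' (p' : seq nat) : ~~ adj u' v' -> v' < u' -> u' < n -> v' < n ->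
    cp u' = cp v' -> walk adj pp (pp u') v' p' ->
    basis M (put_swap (toggles B (map qf p')) (qf (pp u')) (qf v')) /\
    basis M (put_swap (toggles B (map qf p')) (qf v') (qf (pp u'))) ->
    basis M (put_swap (toggles B (map qf (pp u' :: p'))) (qf u') (qf v')) /\
    basis M (put_swap (toggles B (map qf (pp u' :: p'))) (qf v') (qf u')).
  move=> nadj vu un vn ec wk [b1 b2].
  have lt := pp_lt un vu ec.
  have pun := ltn_trans lt un.
  have [//|//||h1 h2 h3 h4 h5] := walk_range wk; first by rewrite cp_pp.
  have [//|//|//|g1 g2 g3 g4 g5] := walk_range (WalkLeft nadj vu wk).
  (* The later vertices lie strictly below [pp u'], the least neighbour of [u'], so none is adjacent
     to [u']: the path is induced. *)
  have le k : k \in p' -> k < pp u'.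
    move=> kp; rewrite ltn_neqAle; apply/andP; split.
      by apply: contraNneq h1 => <-.
    apply: leq_trans (h5 k kp) _; apply: (pp_mono tree _ un).
    by rewrite geq_max (ltnW lt) ltnW.
  have qf_neq i j : i < n -> j < n -> i != j -> qf i != qf j.
    by move=> i_n jn; apply: contraNneq => /qf_inj ->.
  have qf_notin i : i < n -> i \notin p' -> qf i \notin map qf p'.
    move=> i_n; apply: contra => /mapP[j jp /qf_inj ->//].
    by rewrite inE (ltn_trans (le j jp)).
  apply: path_exchange => //=.
  - rewrite qf_notin //= map_inj_in_uniq // => i j /le ip /le jp.
    by apply: qf_inj; rewrite inE; [apply: ltn_trans ip _ | apply: ltn_trans jp _].
  - exact: qf_neq.
  - exact: qf_neq.
  - by apply: qf_neq => //; rewrite eq_sym ltn_eqF.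
  - by apply: qf_notin => //; move: g1; rewrite inE negb_or => /andP[].
  - exact: qf_notin.
  - by rewrite xadjC; apply: (pp_adj tree).
  move=> _ /mapP[z /le zp ->]; rewrite xadjC; exact: (pp_min tree un).
elim=> {u v p} [u v auv|u v p nadj vu wk IH|u v p nadj uv wk IH] un vn ec.
(* With adjacent ends, one of the two sets is [B] itself and the other is an exchange in [B]. *)
- wlog uB : u v auv un vn ec / qf u \in B.
    move=> H; case: (boolP (qf u \in B)) => uB; first exact: H.
    have vB : qf v \in B.
      by move: auv; rewrite /pos_adj /xadj (negPf uB); case: (_ \in B).
    by have [] := H v u _ vn un (esym ec) vB; rewrite // adjC.
  have vB : qf v \notin B.
    by move: auv; rewrite /pos_adj /xadj uB; case: (_ \in B).
  have -> : put_swap B (qf u) (qf v) = B.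
    apply/setP=> x; rewrite in_put_swap; have [->|_] := eqVneq x (qf u); first by rewrite uB.
    by have [->|//] := eqVneq x (qf v); rewrite (negPf vB).
  split=> //; rewrite basis_swap //; rewrite -xadjE // xadjC; exact: auv.
- apply: step => //; apply: IH; rewrite ?cp_pp //.
  exact: leq_ltn_trans (pp_le tree un) un.
have [|||b1 b2] := step v u p _ uv vn un (esym ec).
- by rewrite adjC.
- exact: walk_sym.
- have [//|||b1 b2 //] := IH; last by rewrite cp_pp.
  exact: leq_ltn_trans (pp_le tree vn) vn.
by [].
Qed.

End Walk.

(** * The greedy algorithm *)

Definition greedy_step S x := if indep M (x |: S) then x |: S else S.
Definition greedy (l : seq U) := foldl greedy_step set0 l.

Lemma greedy_rcons l x : greedy (rcons l x) = greedy_step (greedy l) x.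
Proof. by rewrite /greedy -cats1 foldl_cat. Qed.

Lemma greedy_indep l : indep M (greedy l).
Proof.
elim/last_ind: l => [|l x IH]; first exact: indep0.
by rewrite greedy_rcons /greedy_step; case: ifP.
Qed.

Lemma greedy_sub l : {subset greedy l <= l}.
Proof.
elim/last_ind: l => [|l x IH] y; first by rewrite inE.
rewrite greedy_rcons mem_rcons /greedy_step inE.
by case: ifP => _; rewrite ?inE => /predU1P[->|/IH->] || move=> /IH->; rewrite ?eqxx ?orbT.
Qed.

Lemma greedy_cat l1 l2 : greedy l1 \subset greedy (l1 ++ l2).
Proof.
elim/last_ind: l2 => [|l x IH]; first by rewrite cats0.
rewrite -rcons_cat greedy_rcons /greedy_step; case: ifP => // _.
exact: subset_trans IH (subsetUr _ _).
Qed.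

Lemma greedy_reject l1 x l2 : x \notin greedy (l1 ++ x :: l2) ->
  ~~ indep M (x |: greedy l1).
Proof.
apply: contra => ix; rewrite -cat_rcons; apply: (subsetP (greedy_cat _ _)).
by rewrite greedy_rcons /greedy_step ix setU11.
Qed.

Lemma greedy_basis l : (forall x, x \in l) -> basis M (greedy l).
Proof.
move=> full; apply/maxsetP; split=> [|C iC sC]; first exact: greedy_indep.
apply/eqP; rewrite eqEsubset sC andbT; apply/subsetP=> x xC; apply: contraT.
case/splitPr: (full x) sC => l1 l2 sC /greedy_reject/negP[]; apply: indepS iC.
by rewrite subUset sub1set xC (subset_trans (greedy_cat l1 (x :: l2)) sC).
Qed.

(** If [y] came after [x], the set built before [x] would avoid [y], hence lie in [greedy l :\ y],
    and [x] would have been accepted. *)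
Lemma greedy_exchange l x y : uniq l -> x \in l -> x \notin greedy l -> y \in greedy l ->
  indep M (x |: greedy l :\ y) -> index y l < index x l.
Proof.
move=> + xl; case/splitPr: xl => l1 l2; rewrite cat_uniq => /and3P[_ no _] xS yS ixy.
have /negP dx := greedy_reject xS.
have nxl1 : x \notin l1 by apply: contra no => xl1 /=; rewrite xl1.
rewrite [index x _]index_cat (negPf nxl1) /= eqxx addn0 index_cat.
case: ifP => [|yl1]; first by rewrite index_mem.
case: dx; apply: indepS ixy; apply/setUS/subsetP=> z zl1.
rewrite in_setD1 (subsetP (greedy_cat _ _)) // andbT.
by apply: contraFneq yl1 => <-; apply: greedy_sub.
Qed.

(** By [local_opt_min] only exchangeable pairs matter. A class of [lab] is closed under adjacency,
    so [exchange_closed] gives both elements the same label, and [greedy_exchange] orders them in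
    [l]. *)
Lemma greedy_min (R : realType) (w : U -> R) B (lab : U -> nat) l : basis M B ->
  (forall x y, xadj M B x y -> lab x = lab y) ->
  uniq l -> (forall x, x \in l) ->
  (forall x y, index y l < index x l -> lab y = lab x -> (w y <= w x)%R) ->
  min_weight_basis M w (greedy l).
Proof.
move=> bB labP ul full sorted_l; apply: local_opt_min; first exact: greedy_basis.
move=> x y xS yS ixy; apply: sorted_l; first exact: greedy_exchange ixy.
pose K := [set z | lab z == lab x].
have : y \in K.
  apply: (@exchange_closed U M B K (greedy l) x y) => //.
  - by move=> u v; rewrite !inE => /eqP <- /labP->.
  - exact: greedy_basis.
  by rewrite inE.
by rewrite inE => /eqP.
Qed.

End Exchange.

(** * Cost and correctness of programs *)

Fixpoint esize (e : expr) : nat :=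
  match e with
  | Const _ | Reg _ => 1
  | Get _ e1 => (esize e1).+1
  | Bin _ e1 e2 => (esize e1 + esize e2).+1
  end.

Fixpoint small_consts (e : expr) : bool :=
  match e with
  | Const c => c <= 2
  | Reg _ => true
  | Get _ e1 => small_consts e1
  | Bin _ e1 e2 => small_consts e1 && small_consts e2
  end.

(** Cost in words: each of the [esize e] subexpressions has a value of at most [(esize e).+1] words,
    and 1 pays for the instruction. *)
Definition tick (e : expr) : nat := esize e * (esize e).+1 + 1.

Fixpoint written_regs (p : prog) : seq nat :=
  match p with
  | Skip | Put _ _ _ => [::]
  | Assign x _ | Indep x _ | Compare x _ _ => [:: x]
  | Seq p1 p2 | If _ p1 p2 => written_regs p1 ++ written_regs p2
  | While _ p1 => written_regs p1
  end.

Fixpoint written_arrs (p : prog) : seq nat :=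
  match p with
  | Skip | Assign _ _ | Indep _ _ | Compare _ _ _ => [::]
  | Put a _ _ => [:: a]
  | Seq p1 p2 | If _ p1 p2 => written_arrs p1 ++ written_arrs p2
  | While _ p1 => written_arrs p1
  end.

Definition agree (xs bs : seq nat) (s s' : state) : Prop :=
  (forall x, x \notin xs -> regs s' x = regs s x) /\
  (forall a, a \notin bs -> arrs s' a = arrs s a).

Lemma agree_trans xs bs s1 s2 s3 :
  agree xs bs s1 s2 -> agree xs bs s2 s3 -> agree xs bs s1 s3.
Proof.
move=> [r1 a1] [r2 a2]; split=> [x xN|a aN]; first by rewrite r2 ?r1.
by rewrite a2 ?a1.
Qed.

Lemma agree_sub xs bs xs' bs' s s' : {subset xs <= xs'} -> {subset bs <= bs'} ->
  agree xs bs s s' -> agree xs' bs' s s'.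
Proof.
move=> sx sb [r a]; split=> [x|b] H; [apply: r | apply: a].
  by apply: contra H => /sx.
by apply: contra H => /sb.
Qed.

Lemma agree_arr_set n xs bs s s' a : agree xs bs s s' -> a \notin bs ->
  arr_set n s' a = arr_set n s a.
Proof. by case=> _ ag /ag e; apply/setP=> i; rewrite !inE e. Qed.

Lemma arr_set_put n s a (i : 'I_n) v :
  arr_set n (set_arr s a i v) a =
    if v != 0 then i |: arr_set n s a else arr_set n s a :\ i.
Proof.
apply/setP=> j; rewrite !inE /= eqxx /=.
have [->|ji] := eqVneq j i; first by rewrite eqxx; case: ifP => /=; rewrite !inE eqxx.
have -> : (j == i :> nat) = false by apply/negbTE.
by case: ifP; rewrite !inE (negPf ji).
Qed.

Definition incr (x : nat) := Assign x (Bin OpAdd (Reg x) (Const 1)).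
Definition less (e1 e2 : expr) := Bin OpLeq (Bin OpAdd e1 (Const 1)) e2.
(** Truncated subtraction sends every nonzero entry to 0, so entries other than 0 and 1 are flipped
    correctly too. *)
Definition flip (a : nat) (e : expr) := Put a e (Bin OpSub (Const 1) (Get a e)).
Definition for_body (x : nat) (body : prog) := Seq body (incr x).
Definition for_loop (x : nat) (body : prog) := While (less (Reg x) (Reg 0)) (for_body x body).
Definition For (x : nat) (body : prog) := Seq (Assign x (Const 0)) (for_loop x body).

(** * A program logic with bounds on queries and time *)

Section Logic.
Variables (n : nat) (ind : pred {set 'I_n})
  (cmp : {set 'I_n} -> {set 'I_n} -> option comparison).
Hypothesis n_gt0 : 0 < n.

(** The bound [n.+1] leaves room for the comparison code 2 when [n] is 1. *)
Definition bounded (s : state) : Prop :=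
  (forall x, regs s x <= n.+1) /\ (forall a i, arrs s a i <= n.+1).

Definition word : nat := (trunc_log 2 n.+2).+1.

Lemma eval_le s e : bounded s -> small_consts e -> eval s e <= n.+2 ^ esize e.
Proof.
case=> rb ab; have gt0 k : 0 < n.+2 ^ k by rewrite expn_gt0.
elim: e => [c|x|a e IH|o e1 IH1 e2 IH2] /=.
- by rewrite expn1; lia.
- by move=> _; rewrite expn1; apply: leq_trans (rb x) _.
- move=> _; rewrite expnS; apply: leq_trans (ab _ _) _.
  by have := gt0 (esize e); nia.
case/andP=> /IH1 {}IH1 /IH2 {}IH2; rewrite expnS expnD.
move: (gt0 (esize e1)) (gt0 (esize e2)) IH1 IH2.
move: (_ ^ _) (_ ^ _) => p2 p1 p1_gt0 p2_gt0 le1 le2.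
have le12 : p1 + p2 <= n.+2 * (p1 * p2) by nia.
case: o => /=.
- exact: leq_trans (leq_add le1 le2) le12.
- by apply: leq_trans (leq_subr _ _) _; apply: leq_trans le1 _; lia.
- by apply: leq_trans (leq_mul le1 le2) _; rewrite leq_pmull.
- by apply: leq_trans (leq_div _ _) _; apply: leq_trans le1 _; lia.
- by apply: leq_trans (leq_b1 _) _; lia.
by apply: leq_trans (leq_b1 _) _; lia.
Qed.

Lemma bits_le k v : v <= n.+2 ^ k -> bits v <= k.+1 * word.
Proof.
move=> le; have b_lt : n.+2 < 2 ^ word by apply: trunc_log_ltn.
have : v <= 2 ^ (word * k).
  apply: leq_trans le _; rewrite expnM.
  by case: k => // k; rewrite leq_exp2r // ltnW.
rewrite /bits => /(leq_trunc_log 2); rewrite trunc_expnK //= mulSn mulnC.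
by rewrite addnC; move=> H; apply: leq_ltn_trans H _; rewrite -addn1 leq_add2l.
Qed.

Lemma cost_le s e : bounded s -> small_consts e ->
  1 + cost s e <= tick e * word.
Proof.
move=> bs; have w_gt0 : 0 < word by [].
suff: small_consts e -> cost s e <= esize e * (esize e).+1 * word.
  by move=> H /H{}H; rewrite /tick mulnDl addnC mul1n leq_add.
elim: e => [c|x|a e IH|o e1 IH1 e2 IH2] sm.
- by have := bits_le (eval_le bs sm); rewrite /= addn0.
- by have := bits_le (eval_le bs sm); rewrite /= addn0.
- apply: leq_trans (leq_add (bits_le (eval_le bs sm)) (IH sm)) _.
  by rewrite -mulnDl leq_mul2r /=; nia.
have /= /andP[/IH1 {}IH1 /IH2 {}IH2] := sm.
apply: leq_trans (leq_add (bits_le (eval_le bs sm)) (leq_add IH1 IH2)) _.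
by rewrite -!mulnDl leq_mul2r /=; nia.
Qed.

(* Time is measured in units of [word], which bounds the bit length of the
   numbers handled up to a constant factor. *)
Definition runs (p : prog) (s : state) (q t : nat) (Post : state -> Prop) : Prop :=
  exists s' q' t',
    [/\ exec ind cmp p s s' q' t', q' <= q, t' <= t * word, bounded s' & Post s'].

Lemma runs_weaken p s q t q' t' (P P' : state -> Prop) :
  runs p s q t P -> q <= q' -> t <= t' -> (forall s', bounded s' -> P s' -> P' s') ->
  runs p s q' t' P'.
Proof.
move=> [s' [q1 [t1 [ex lq lt bs Ps]]]] lq' lt' PP'; exists s', q1, t1; split=> //.
- exact: leq_trans lq lq'.
- by apply: leq_trans lt _; rewrite leq_mul2r lt' orbT.
exact: PP'.
Qed.

Lemma runs_le p s q t q' t' (P : state -> Prop) :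
  runs p s q t P -> q <= q' -> t <= t' -> runs p s q' t' P.
Proof. by move=> H lq lt; apply: (runs_weaken H). Qed.

Lemma runs_conseq p s q t (P P' : state -> Prop) :
  runs p s q t P -> (forall s', bounded s' -> P s' -> P' s') -> runs p s q t P'.
Proof. by move=> H PP'; apply: (runs_weaken H). Qed.

(** Which registers and arrays may change is read off the syntax; [runs_frame] then spares
    postconditions from listing what is preserved. *)
Lemma exec_agree p s s' q t : exec ind cmp p s s' q t ->
  agree (written_regs p) (written_arrs p) s s'.
Proof.
elim=> {p s s' q t} //=.
- by move=> s x e; split=> // y; rewrite inE /= => /negPf ->.
- by move=> s a e1 e2; split=> // b; rewrite inE /= => /negPf ->.
- move=> p1 p2 s s1 s2 q1 q2 t1 t2 _ a1 _ a2; apply: agree_trans (agree_sub _ _ a1) (agree_sub _ _ a2);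
    by move=> x; rewrite mem_cat => ->; rewrite ?orbT.
- move=> e p1 p2 s s1 q t _; case: ifP => _; apply: agree_sub;
    by move=> x; rewrite mem_cat => ->; rewrite ?orbT.
- move=> e p s s1 s2 q1 q2 t1 t2 _ _ a1 _; exact: agree_trans.
- by move=> s x a; split=> // y; rewrite inE /= => /negPf ->.
by move=> s x a b c _; split=> // y; rewrite inE /= => /negPf ->.
Qed.

Lemma runs_frame p s q t (P P' : state -> Prop) :
  runs p s q t P ->
  (forall s', bounded s' -> agree (written_regs p) (written_arrs p) s s' -> P s' -> P' s') ->
  runs p s q t P'.
Proof.
move=> [s' [q1 [t1 [ex lq lt bs Ps]]]] H; exists s', q1, t1; split=> //.
by apply: H => //; apply: exec_agree ex.
Qed.

Lemma runs_skip s (P : state -> Prop) : bounded s -> P s -> runs Skip s 0 1 P.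
Proof. by move=> bs Ps; exists s, 0, 1; split=> //; constructor. Qed.

Lemma runs_assign s x e (P : state -> Prop) : bounded s -> small_consts e ->
  eval s e <= n.+1 -> P (set_reg s x (eval s e)) -> runs (Assign x e) s 0 (tick e) P.
Proof.
move=> bs sm le Ps; exists (set_reg s x (eval s e)), 0, (1 + cost s e).
split=> //; [exact: ExecAssign | exact: cost_le |].
by case: bs => rb ab; split=> //= y; case: ifP.
Qed.

Lemma runs_put s a e1 e2 (P : state -> Prop) : bounded s ->
  small_consts e1 -> small_consts e2 ->
  eval s e2 <= n.+1 -> P (set_arr s a (eval s e1) (eval s e2)) ->
  runs (Put a e1 e2) s 0 (tick e1 + tick e2) P.
Proof.
move=> bs sm1 sm2 le Ps.
exists (set_arr s a (eval s e1) (eval s e2)), 0, (1 + cost s e1 + cost s e2).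
split=> //; first exact: ExecPut.
  have := cost_le bs sm1; have := cost_le bs sm2; rewrite mulnDl; lia.
by case: bs => rb ab; split=> //= b i; case: ifP.
Qed.

Lemma runs_seq p1 p2 s q1 q2 t1 t2 (P : state -> Prop) :
  runs p1 s q1 t1 (fun s1 => bounded s1 -> runs p2 s1 q2 t2 P) ->
  runs (Seq p1 p2) s (q1 + q2) (t1 + t2) P.
Proof.
move=> [s1 [q1' [t1' [ex1 lq1 lt1 bs1 /(_ bs1) [s2 [q2' [t2' [ex2 lq2 lt2 bs2 Ps]]]]]]]].
exists s2, (q1' + q2'), (t1' + t2'); split=> //.
- exact: ExecSeq ex1 ex2.
- exact: leq_add.
by rewrite mulnDl leq_add.
Qed.

Lemma runs_if e p1 p2 s q1 q2 t1 t2 (P : state -> Prop) : bounded s -> small_consts e ->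
  (eval s e != 0 -> runs p1 s q1 t1 P) -> (eval s e = 0 -> runs p2 s q2 t2 P) ->
  runs (If e p1 p2) s (maxn q1 q2) (tick e + maxn t1 t2) P.
Proof.
move=> bs sm H1 H2; have ce := cost_le bs sm.
have [ev|ev] := boolP (eval s e != 0).
  have [s' [q [t [ex lq lt bs' Ps]]]] := H1 ev.
  exists s', q, (1 + cost s e + t); split=> //; first by apply: ExecIf; rewrite ev.
    by rewrite leq_max lq.
  by rewrite mulnDl leq_add // (leq_trans lt) // leq_mul2r leq_maxl orbT.
have [s' [q [t [ex lq lt bs' Ps]]]] := H2 (eqP (negbNE ev)).
exists s', q, (1 + cost s e + t); split=> //; first by apply: ExecIf; rewrite (negPf ev).
  by rewrite leq_max lq orbT.
by rewrite mulnDl leq_add // (leq_trans lt) // leq_mul2r leq_maxr orbT.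
Qed.

Lemma runs_while_stop e p s (P : state -> Prop) : bounded s -> small_consts e ->
  eval s e = 0 -> P s -> runs (While e p) s 0 (tick e) P.
Proof.
move=> bs sm ev Ps; exists s, 0, (1 + cost s e); split=> //; last exact: cost_le.
exact: ExecWhileStop.
Qed.

Lemma runs_while_step e p s q1 q2 t1 t2 (P : state -> Prop) : bounded s -> small_consts e ->
  eval s e != 0 ->
  runs p s q1 t1 (fun s1 => bounded s1 -> runs (While e p) s1 q2 t2 P) ->
  runs (While e p) s (q1 + q2) (tick e + t1 + t2) P.
Proof.
move=> bs sm ev [s1 [q1' [t1' [ex1 lq1 lt1 bs1 /(_ bs1) [s2 [q2' [t2' [ex2 lq2 lt2 bs2 Ps]]]]]]]].
exists s2, (q1' + q2'), (1 + cost s e + t1' + t2'); split=> //.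
- by apply: ExecWhileStep ex1 ex2; apply/eqP.
- exact: leq_add.
by rewrite (mulnDl (tick e + t1)) (mulnDl (tick e)); apply: leq_add lt2; apply: leq_add lt1; apply: cost_le.
Qed.

Lemma runs_indep s x a (P : state -> Prop) : bounded s ->
  P (set_reg s x (ind (arr_set n s a))) -> runs (Indep x a) s 0 1 P.
Proof.
move=> bs Ps; exists (set_reg s x (ind (arr_set n s a))), 0, 1.
split=> //; first exact: ExecIndep.
by case: bs => rb ab; split=> //= y; case: ifP => // _; apply: leq_trans (leq_b1 _) _.
Qed.

Lemma runs_compare s x a b c (P : state -> Prop) : bounded s ->
  cmp (arr_set n s a) (arr_set n s b) = Some c ->
  P (set_reg s x (comparison_code c)) -> runs (Compare x a b) s 1 1 P.
Proof.
move=> bs ec Ps; exists (set_reg s x (comparison_code c)), 1, 1.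
split=> //; first exact: ExecCompare.
by case: bs => rb ab; split=> //= y; case: ifP => // _; case: (c) => //=; rewrite ltnS.
Qed.

Lemma runs_flip s a e (i : 'I_n) (P : state -> Prop) : bounded s -> small_consts e ->
  eval s e = i ->
  (forall s', bounded s' -> regs s' = regs s ->
     (forall b, b != a -> arrs s' b = arrs s b) ->
     arr_set n s' a = toggle (arr_set n s a) i -> P s') ->
  runs (flip a e) s 0 (2 * esize e ^ 2 + 20 * esize e + 40) P.
Proof.
move=> bs sm ev H; rewrite /flip.
have B' : bounded (set_arr s a i (1 - arrs s a i)).
  case: bs => rb ab; split=> //= b j; case: ifP => // _.
  by apply: leq_trans (leq_subr _ _) _.
apply: runs_weaken (_ : runs _ s 0 (tick e + tick (Bin OpSub (Const 1) (Get a e))) P) _ _ _ => //; last first.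
  by rewrite /tick /=; nia.
apply: runs_put; rewrite //= ev.
  by apply: leq_trans (leq_subr _ _) _.
apply: H => //.
  by move=> b ba /=; rewrite (negPf ba).
rewrite arr_set_put /toggle inE.
by case: (arrs s a i).
Qed.

(** The body must establish the invariant for the state with the counter already advanced, as
    [for_body] increments it afterwards. Per round, 50 covers the loop test and the increment; the
    final 50 covers the initialisation and the failing test. *)
Lemma runs_for x body s0 q t (Inv : nat -> state -> Prop) :
  bounded s0 -> regs s0 0 = n -> x != 0 -> x \notin written_regs body ->
  0 \notin written_regs body ->
  Inv 0 (set_reg s0 x 0) ->
  (forall i s, i < n -> bounded s -> regs s x = i -> regs s 0 = n ->
     agree (x :: written_regs body) (written_arrs body) s0 s -> Inv i s ->
     runs body s q t (fun s' => Inv i.+1 (set_reg s' x i.+1))) ->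
  runs (For x body) s0 (n * q) (n * (t + 50) + 50)
    (fun s' => [/\ Inv n s', regs s' 0 = n &
       agree (x :: written_regs body) (written_arrs body) s0 s']).
Proof.
move=> bs0 r0 x0 xb zb I0 step.
pose ag := agree (x :: written_regs body) (written_arrs body) s0.
pose P s' := [/\ Inv n s', regs s' 0 = n & ag s'].
have loop i s : i <= n -> bounded s -> regs s x = i -> ag s -> Inv i s ->
    runs (for_loop x body) s ((n - i) * q) ((n - i) * (t + 50) + 45) P.
  move: {2}(n - i) (erefl (n - i)) => k; elim: k i s => [|k IH] i s ek le bs rx as_ Is.
    have ei : i = n by lia.
    have rs0 : regs s 0 = n by rewrite (proj1 as_) ?r0 // inE negb_or eq_sym x0.
    apply: runs_weaken (runs_while_stop _ bs _ _ (_ : P s)) _ _ _ => //=.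
    - by rewrite rx rs0 ei; apply/eqP; lia.
    - by split=> //; rewrite -ei.
    by rewrite ek.
  have rs0 : regs s 0 = n by rewrite (proj1 as_) ?r0 // inE negb_or eq_sym x0.
  have lt : i < n by lia.
  rewrite ek; have ek' : n - i.+1 = k by lia.
  suff H : runs (for_body x body) s (q + 0) (t + tick (Bin OpAdd (Reg x) (Const 1)))
      (fun s1 => bounded s1 -> runs (for_loop x body) s1 (k * q) (k * (t + 50) + 45) P).
    apply: runs_weaken (runs_while_step bs _ _ H) _ _ _ => //=.
    - by rewrite rx rs0; lia.
    - by rewrite addn0 mulSn.
    by rewrite /tick /=; lia.
  apply: runs_seq; apply: runs_frame (step i s lt bs rx rs0 as_ Is) _.
  move=> s' bs' ag' Is' _.
  have rx' : regs s' x = i by rewrite (proj1 ag') ?rx.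
  apply: runs_assign => //=; rewrite ?rx' ?addn1; first lia.
  move=> bs''; rewrite -ek'; apply: IH => //=; rewrite ?eqxx ?addn1 //.
  apply: agree_trans as_ _; apply: (agree_trans (s2 := s')).
    by apply: agree_sub ag' => // y; rewrite inE orbC => ->.
  by split=> // y; rewrite inE /= negb_or => /andP[/negPf ->].
suff H : runs (For x body) s0 (0 + (n - 0) * q)
    (tick (Const 0) + ((n - 0) * (t + 50) + 45)) P.
  apply: (runs_weaken H) => //; first by rewrite subn0 add0n.
  by rewrite subn0 /tick /=; lia.
apply: runs_seq; apply: runs_assign => //= bs1; apply: loop => //=; rewrite ?eqxx //.
by split=> // y; rewrite inE /= negb_or => /andP[/negPf ->].
Qed.

End Logic.

(** * Breadth first search *)

(* Register 0 holds [n].  Array 0 holds the current independent set, and the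
   fixed basis [B] between the two greedy phases; 3 the breadth first queue;
   4 and 5 the parent positions [pp] and the component labels [cp]; 6 the order
   being sorted; 7 and 8 the two bases of a query; 9 the visited vertices. *)

Notation "p1 ;; p2" := (Seq p1 p2) (at level 90, right associativity).

Definition iszero (e : expr) := Bin OpEq e (Const 0).

Definition test_adj : prog :=
  Assign 22 (Bin OpEq (Bin OpAdd (iszero (Get 0 (Reg 20))) (iszero (Get 0 (Reg 21)))) (Const 1)) ;;
  If (Reg 22)
    (flip 0 (Reg 20) ;; flip 0 (Reg 21) ;; Indep 22 0 ;; flip 0 (Reg 20) ;; flip 0 (Reg 21))
    Skip.

Definition greedy_prog : prog :=
  For 1 (Assign 5 (Get 6 (Reg 1)) ;; Put 0 (Reg 5) (Const 1) ;; Indep 6 0 ;;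
         If (Reg 6) Skip (Put 0 (Reg 5) (Const 0))).

(** Register 1 runs over queue positions. When it has caught up with the queue length in register 2,
    the next unseen vertex becomes a root, with its own position as parent and label. *)
Definition bfs_prog : prog :=
  Assign 2 (Const 0) ;; Assign 3 (Const 0) ;;
  For 1 (For 4 (
    If (iszero (Get 9 (Reg 4)))
      (If (Bin OpEq (Reg 2) (Reg 1))
         (Assign 3 (Reg 1) ;; Assign 22 (Const 1))
         (Assign 20 (Get 3 (Reg 1)) ;; Assign 21 (Reg 4) ;; test_adj) ;;
       If (Reg 22)
         (Put 3 (Reg 2) (Reg 4) ;; Put 4 (Reg 2) (Reg 1) ;; Put 5 (Reg 2) (Reg 3) ;;
          Put 9 (Reg 4) (Const 1) ;; incr 2)
         Skip)
      Skip)).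

Definition upd (f : nat -> nat) (i v : nat) := fun j => if j == i then v else f j.

(* [h] is the position being expanded, [v] the next candidate neighbour, [t] the
   length of the queue and [c] the label of the current component. *)
Record bfs_inv (n : nat) (vadj : rel nat) (h v t c : nat) (Q pp cp seen : nat -> nat) :
    Prop := BfsInv {
  bi_ht : h <= t;
  bi_tn : t <= n;
  bi_Q : forall k, k < t -> Q k < n;
  bi_inj : forall i k, i < t -> k < t -> Q i = Q k -> i = k;
  bi_seen : forall x, x < n -> seen x <> 0 -> exists2 k, k < t & Q k = x;
  bi_unseen : forall k, k < t -> seen (Q k) <> 0;
  bi_pp : forall k, k < t -> pp k <= k /\ pp k <= h;
  bi_mono : forall i k, i <= k -> k < t -> pp i <= pp k;
  bi_adj : forall k, k < t -> pp k < k -> vadj (Q (pp k)) (Q k);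
  bi_min : forall i k, k < t -> i < pp k -> ~~ vadj (Q i) (Q k);
  bi_new : forall i x, x < n -> seen x = 0 -> i < h -> ~~ vadj (Q i) x;
  bi_cur : forall x, x < v -> seen x = 0 -> h < t /\ ~~ vadj (Q h) x;
  bi_cle : forall k, k < t -> cp k <= k;
  bi_croot : forall k, k < t -> pp k = k -> cp k = k;
  bi_cc : forall i k, k < t -> pp k <= i -> i <= k -> cp i = cp k;
  bi_cq : forall k, h <= k -> k < t -> cp k = c }.

(** * Preservation of the search invariant *)

Section Bfs.
Variables (n : nat) (vadj : rel nat).
Notation inv := (bfs_inv n vadj).

Lemma bfs_inv_init Q pp cp seen : (forall x, x < n -> seen x = 0) -> inv 0 0 0 0 Q pp cp seen.
Proof. by move=> un; split=> // x xn; rewrite un. Qed.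

Lemma bfs_inv_skip h v t c Q pp cp seen : inv h v t c Q pp cp seen ->
  (seen v = 0 -> h < t /\ ~~ vadj (Q h) v) -> inv h v.+1 t c Q pp cp seen.
Proof.
move=> [] *; split=> // x; rewrite ltnS leq_eqVlt => /orP[/eqP->|]; auto.
Qed.

Lemma bfs_inv_root h v t c Q pp cp seen : inv h v t c Q pp cp seen -> t = h ->
  inv h v t h Q pp cp seen.
Proof. by move=> [] *; split=> // k; lia. Qed.

Lemma bfs_inv_lt h v t c Q pp cp seen : inv h v t c Q pp cp seen -> v < n -> seen v = 0 ->
  t < n.
Proof.
move=> I vn sv; have u : uniq (v :: map Q (iota 0 t)).
  rewrite /= map_inj_in_uniq ?iota_uniq ?andbT => [|i k].
    apply/mapP=> -[k]; rewrite mem_iota => /andP[_ kt] e.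
    by case: (bi_unseen I kt); rewrite -e.
  by rewrite !mem_iota => /andP[_ it] /andP[_ kt]; apply: (bi_inj I).
have := @uniq_leq_size _ _ (iota 0 n) u; rewrite /= size_map !size_iota; apply.
move=> x; rewrite inE mem_iota => /predU1P[->//|/mapP[k]].
by rewrite mem_iota => /andP[_ kt] ->; apply: (bi_Q I).
Qed.

(** The disjunction covers a new root and a neighbour of the expanded vertex. Monotonicity of [pp]
    persists because all earlier parents are at most [h]. *)
Lemma bfs_inv_push h v t c Q pp cp seen : inv h v t c Q pp cp seen ->
  v < n -> seen v = 0 -> (t = h /\ c = h) \/ (h < t /\ vadj (Q h) v) ->
  inv h v.+1 t.+1 c (upd Q t v) (upd pp t h) (upd cp t c) (upd seen v 1).
Proof.
move=> I vn sv new; have tn := bfs_inv_lt I vn sv.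
have ht := bi_ht I.
have ltE k : k < t -> (k == t) = false by move=> kt; rewrite ltn_eqF.
have qt k : k < t -> Q k != v.
  by move=> kt; apply/eqP=> e; case: (bi_unseen I kt); rewrite e.
split; rewrite /upd.
- lia.
- exact: tn.
- move=> k; rewrite ltnS leq_eqVlt => /orP[/eqP->|kt]; first by rewrite eqxx.
  by rewrite ltE //; apply: (bi_Q I).
- move=> i k; rewrite !ltnS leq_eqVlt => /orP[/eqP->|it]; rewrite leq_eqVlt => /orP[/eqP->|kt] //;
    rewrite ?eqxx ?ltE //; [move=> e | move=> e | exact: (bi_inj I)].
    by have := qt _ kt; rewrite -e eqxx.
  by have := qt _ it; rewrite e eqxx.
- move=> x xn; have [->|xv] := eqVneq x v; first by move=> _; exists t; rewrite ?eqxx.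
  by move=> /(bi_seen I xn)[k kt <-]; exists k; [exact: ltnW | rewrite ltE].
- move=> k; rewrite ltnS leq_eqVlt => /orP[/eqP->|kt]; first by rewrite !eqxx.
  by rewrite ltE // (negPf (qt _ kt)); apply: (bi_unseen I).
- move=> k; rewrite ltnS leq_eqVlt => /orP[/eqP->|kt]; first by rewrite eqxx; lia.
  by rewrite ltE //; apply: (bi_pp I).
- move=> i k ik; rewrite ltnS leq_eqVlt => /orP[/eqP ek|kt].
    rewrite ek eqxx; case: eqP => [//|ne]; by have /(bi_pp I)[] : i < t by lia.
  by rewrite !ltE //; [apply: (bi_mono I) | lia].
- move=> k; rewrite ltnS leq_eqVlt => /orP[/eqP->|kt].
    by rewrite !eqxx => {}ht; rewrite ltE //; lia.
  rewrite !(ltE k) // => lt; rewrite ltE; last lia.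
  exact: (bi_adj I).
(* The parent [h] is the least neighbour of [v]: an unseen vertex has no neighbour among the
   expanded positions. *)
- move=> i k; rewrite ltnS leq_eqVlt => /orP[/eqP->|kt].
    rewrite !eqxx => ih; rewrite ltE; last lia.
    exact: (bi_new I).
  rewrite !(ltE k) // => lt; rewrite ltE; last by have [] := bi_pp I kt; lia.
  exact: (bi_min I).
- move=> i x xn; case: eqP => // xv sx ih; rewrite ltE; last lia.
  exact: (bi_new I).
- move=> x xv; case: eqP => // ne sx; have xlt : x < v by lia.
  have [ltt nadj] := bi_cur I xlt sx; rewrite ltE //; lia.
- move=> k; rewrite ltnS leq_eqVlt => /orP[/eqP->|kt].
    by rewrite eqxx; case: new => [|[hlt _]]; [lia|rewrite -(bi_cq I (leqnn h) hlt)]; have := bi_cle I hlt; lia.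
  by rewrite ltE //; apply: (bi_cle I).
- move=> k; rewrite ltnS leq_eqVlt => /orP[/eqP->|kt]; first by rewrite !eqxx; lia.
  by rewrite !ltE //; apply: (bi_croot I).
- move=> i k; rewrite ltnS leq_eqVlt => /orP[/eqP->|kt].
    rewrite !eqxx => hi; rewrite leq_eqVlt; case: eqP => //= _ it.
    exact: (bi_cq I).
  rewrite !(ltE k) // => pi ik; rewrite ltE; last lia.
  exact: (bi_cc I).
- move=> k hk; rewrite ltnS leq_eqVlt => /orP[/eqP->|kt]; first by rewrite eqxx.
  by rewrite ltE //; apply: (bi_cq I).
Qed.

Lemma bfs_inv_full h v t c Q pp cp seen : inv h v t c Q pp cp seen ->
  (forall x, x < n -> seen x <> 0) -> n <= t.
Proof.
move=> I full; have := @uniq_leq_size _ (iota 0 n) (map Q (iota 0 t)) (iota_uniq _ _).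
rewrite size_map !size_iota; apply=> x; rewrite mem_iota => /andP[_ xn].
have [k kt <-] := bi_seen I xn (full x xn).
by apply: map_f; rewrite mem_iota.
Qed.

(** If the queue were exhausted after the full scan, [bi_cur] would make every vertex seen, and so
    [n <= t <= h]. *)
Lemma bfs_inv_next h t c Q pp cp seen : inv h n t c Q pp cp seen -> h < n ->
  inv h.+1 0 t c Q pp cp seen.
Proof.
move=> I hn; have ht : h < t.
  rewrite ltnNge; apply/negP=> th.
  suff : n <= t by lia.
  by apply: (bfs_inv_full I) => x xn sx; have [] := bi_cur I xn sx; lia.
case: (I) => *; split=> //.
- by move=> k /(bi_pp I)[]; lia.
- move=> i x xn sx; rewrite ltnS leq_eqVlt => /orP[/eqP->|]; last exact: (bi_new I).
  by have [] := bi_cur I xn sx.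
by move=> k hk; apply: (bi_cq I); lia.
Qed.

Lemma bfs_inv_tree t c Q pp cp seen : inv n 0 t c Q pp cp seen ->
  t = n /\ bfs_tree n (relpre Q vadj) pp cp.
Proof.
move=> I; have et : t = n by have := bi_ht I; have := bi_tn I; lia.
split=> //; subst t; case: I => *; split=> //=; first by firstorder.
by move=> i k kn /andP[]; auto.
Qed.

End Bfs.

(** * Correctness of the adjacency test, the greedy program and the search *)

Section Programs.
Variables (n : nat) (M : matroid 'I_n)
  (cmp : {set 'I_n} -> {set 'I_n} -> option comparison) (x0 : 'I_n).
Notation runs := (runs (indep M) cmp).

Lemma n_gt0 : 0 < n.
Proof. by case: n x0 => [[]|]. Qed.
#[local] Hint Resolve n_gt0 : core.

Lemma runs_test_adj s (x y : 'I_n) : bounded n s -> regs s 20 = x -> regs s 21 = y ->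
  runs test_adj s 0 500 (fun s' =>
    arr_set n s' 0 = arr_set n s 0 /\ regs s' 22 = xadj M (arr_set n s 0) x y).
Proof.
move=> bs rx ry.
eapply runs_le; [eapply runs_seq; eapply runs_assign|idtac|idtac] => //=.
  by case: (_ == 1).
rewrite rx ry; set c := nat_of_bool _ => b1.
have cE : c = ((x \in arr_set n s 0) != (y \in arr_set n s 0)).
  by rewrite /c !inE; case: (arrs s 0 x == 0); case: (arrs s 0 y == 0).
eapply runs_if => //= [cT|c0].
  eapply runs_seq; eapply runs_flip with (i := x) => //= s2 b2 r2 _ a2 _.
  eapply runs_seq; eapply runs_flip with (i := y) => //=; first by rewrite r2.
  move=> s3 b3 r3 _ a3 _.
  eapply runs_seq; eapply runs_indep => //= b4.
  eapply runs_seq; eapply runs_flip with (i := x) => //=; first by rewrite r3 r2.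
  move=> s5 b5 r5 _ a5 _.
  eapply runs_flip with (i := y) => //=; first by rewrite r5 /= r3 r2.
  move=> s6 b6 r6 _ a6.
  have e3 : arr_set n s3 0 = toggle (toggle (arr_set n s 0) x) y by rewrite a3 a2.
  split.
    rewrite a6 a5; change (toggle (toggle (arr_set n s3 0) x) y = arr_set n s 0).
    by rewrite e3; apply/setP=> z; rewrite !in_toggle; do 3 case: (_ \in _) || case: (_ == _).
  rewrite r6 r5 /= /xadj -e3; case: (_ != _) cE cT => [_ _|->//]; exact: erefl.
eapply runs_skip => //=; split => //; rewrite c0.
by rewrite /xadj; case: (_ != _) cE c0 => // ->.
- by [].
by [].
Qed.

Definition array_is (s : state) (a : nat) (l : seq 'I_n) :=
  forall k, k < size l -> arrs s a k = nth x0 l k.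

Lemma runs_greedy s (l : seq 'I_n) : bounded n s -> regs s 0 = n -> size l = n ->
  array_is s 6 l -> arr_set n s 0 = set0 ->
  runs greedy_prog s 0 (n * 100 + 50) (fun s' => arr_set n s' 0 = greedy M l).
Proof.
move=> bs r0 sl al a0.
pose Inv k s' := arr_set n s' 0 = greedy M (take k l).
eapply runs_weaken; [apply: (@runs_for n _ _ n_gt0 1 _ s 0 50 Inv) => //|..] => //=.
- by rewrite /Inv take0.
- move=> i s1 lt b1 ri rn ag I1.
  have e6 : arrs s1 6 i = nth x0 l i by rewrite (proj2 ag) // al ?sl.
  eapply runs_le; [eapply runs_seq; eapply runs_assign|idtac|idtac] => //=.
    by rewrite ri e6 ltnW // ltnS ltnW.
  rewrite ri e6 => b2.
  eapply runs_seq; eapply runs_put => //= b3.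
  eapply runs_seq; eapply runs_indep => //=; rewrite arr_set_put /= => b4.
  have eT : take i.+1 l = rcons (take i l) (nth x0 l i) by rewrite -take_nth ?sl.
  eapply runs_if => //= [cT|c0].
    eapply runs_skip => //; rewrite /Inv eT greedy_rcons /greedy_step -I1.
    move: cT; case: ifP => // _ _; exact: (arr_set_put (set_reg s1 5 _) 0 _ 1).
  eapply runs_put => //=; rewrite /Inv eT greedy_rcons /greedy_step -I1.
  move: c0; case: ifP => // ni _.
  (* A rejected element was absent before its tentative insertion, so erasing it restores the
     set. *)
  have xN : nth x0 l i \notin arr_set n s1 0.
    apply: contraFN ni => xS; rewrite (setUidPr _) ?sub1set // I1; exact: greedy_indep.
  etransitivity; first exact: (arr_set_put (set_reg (set_arr (set_reg s1 5 _) 0 _ 1) 6 _) 0 _ 0).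
  rewrite /=; set s2 := set_reg _ 6 0.
  have -> : arr_set n s2 0 = nth x0 l i |: arr_set n s1 0.
    exact: (arr_set_put (set_reg s1 5 _) 0 _ 1).
  by rewrite setU1K.
- by [].
- by [].
- by rewrite muln0.
by move=> s1 _ [] + _ _; rewrite /Inv take_oversize ?sl.
Qed.

Definition elt (k : nat) : 'I_n := insubd x0 k.

Lemma eltE k : k < n -> elt k = k :> nat.
Proof. by move=> kn; rewrite /elt val_insubd kn. Qed.

Definition vadj (B : {set 'I_n}) : rel nat := fun x y => xadj M B (elt x) (elt y).

Definition bfs_state (B : {set 'I_n}) (h v : nat) (s : state) : Prop :=
  bfs_inv n (vadj B) h v (regs s 2) (regs s 3) (arrs s 3) (arrs s 4) (arrs s 5) (arrs s 9)
  /\ arr_set n s 0 = B.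

Lemma runs_bfs_body B s h v : bounded n s -> regs s 0 = n -> regs s 1 = h -> regs s 4 = v ->
  h < n -> v < n -> bfs_state B h v s ->
  runs (If (iszero (Get 9 (Reg 4)))
      (If (Bin OpEq (Reg 2) (Reg 1))
         (Assign 3 (Reg 1) ;; Assign 22 (Const 1))
         (Assign 20 (Get 3 (Reg 1)) ;; Assign 21 (Reg 4) ;; test_adj) ;;
       If (Reg 22)
         (Put 3 (Reg 2) (Reg 4) ;; Put 4 (Reg 2) (Reg 1) ;; Put 5 (Reg 2) (Reg 3) ;;
          Put 9 (Reg 4) (Const 1) ;; incr 2)
         Skip)
      Skip) s 0 900 (bfs_state B h v.+1).
Proof.
move=> bs r0 r1 r4 hn vn [I a0].
eapply runs_le; [eapply runs_if|idtac|idtac] => //=.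
- rewrite r4 eqb0 negbK => /eqP sv.
  pose new c t Q := (t = h /\ c = h) \/ (h < t /\ vadj B (Q h) v).
  (* Common outcome of both branches: register 22 decides whether [v] is pushed, together with the
     premise of [bfs_inv_push] or [bfs_inv_skip]. *)
  pose mid s1 := [/\ bfs_state B h v s1,
    agree [:: 3; 20; 21; 22] [:: 0] s s1,
    regs s1 22 <> 0 -> new (regs s1 3) (regs s1 2) (arrs s1 3)
    & regs s1 22 = 0 -> h < regs s1 2 /\ ~~ vadj B (arrs s1 3 h) v].
  eapply runs_seq.
  eapply (@runs_weaken n _ _ _ _ 0 700 0 700 mid) => //.
    eapply runs_le; [eapply runs_if|idtac|idtac] => //=.
    + rewrite r1 eqb0 negbK => /eqP ht.
      eapply runs_seq; eapply runs_assign => //=; first by rewrite r1 ltnW // ltnW.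
      rewrite r1 => b1.
      eapply runs_assign => //=; split=> //=.
      * by split=> //=; rewrite ht; rewrite ht in I; apply: bfs_inv_root I _.
      * by split=> // y; rewrite !inE /= => /norP[/negPf-> /norP[_ /norP[_ /negPf->]]].
      by move=> _; left.
    + rewrite r1 => /eqP; rewrite eqb0 => /eqP ht.
      have hlt : h < regs s 2 by have := bi_ht I; lia.
      have qn := bi_Q I hlt.
      eapply runs_seq; eapply runs_assign => //=; first by rewrite r1 ltnW // ltnW.
      rewrite r1 => b1.
      eapply runs_seq; eapply runs_assign => //=; first by rewrite r4 ltnW // ltnW.
      rewrite r4 => b2.
      eapply runs_frame.
        by apply: (@runs_test_adj _ (elt (arrs s 3 h)) (elt v)); rewrite //= eltE.
      move=> s3 b3 ag [/= a3 r3]; have a0' : arr_set n s3 0 = B by rewrite a3.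
      have [/= agr aga] := ag.
      have ag' : agree [:: 3; 20; 21; 22] [:: 0] s s3.
        split=> [y|b].
          rewrite !inE => /norP[_ /norP[y20 /norP[y21 y22]]].
          rewrite agr /= ?(negPf y20) ?(negPf y21) //.
          by rewrite !inE !negb_or y22.
        by rewrite inE => b0; rewrite aga //= !inE !negb_or b0.
      have e3 : regs s3 22 = vadj B (arrs s 3 h) v by rewrite r3 -a0.
      have [agr' aga'] := ag'.
      have r33 : regs s3 3 = regs s 3 by rewrite agr.
      split=> //=.
      * by split=> //; rewrite !aga' // r33 agr'.
      * rewrite r33 (agr' 2) // aga' // e3 => /eqP; rewrite eqb0 negbK => ad; by right.
      by rewrite (agr' 2) // aga' // e3 => /eqP; rewrite eqb0.
    + by [].
    by [].
  move=> s1 b1 [[I1 a1] [/= agr aga] new1 new0] _.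
  have rn : regs s1 0 = n by rewrite agr.
  have rh : regs s1 1 = h by rewrite agr.
  have rv : regs s1 4 = v by rewrite agr.
  have sv1 : arrs s1 9 v = 0 by rewrite aga.
  have tn := bfs_inv_lt I1 vn sv1.
  eapply runs_if => //= [/eqP/new1 nw|/new0 nw]; last first.
    by apply: runs_skip => //; split=> //; apply: bfs_inv_skip I1 _.
  have cle : regs s1 3 <= n.+1 by case: b1.
  eapply runs_seq; eapply runs_put => //=; first by rewrite rv ltnW // ltnW.
  move=> b2; eapply runs_seq; eapply runs_put => //=; first by rewrite rh ltnW // ltnW.
  move=> b3; eapply runs_seq; eapply runs_put => //=.
  move=> b4; eapply runs_seq; eapply runs_put => //=.
  move=> b5; eapply runs_assign => //=; first by rewrite addn1 ltnW.
  split; last by rewrite -a1.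
  rewrite /= rv rh addn1; exact: bfs_inv_push nw.
by move=> sv; apply: runs_skip => //; split=> //; apply: bfs_inv_skip I _; rewrite r4 in sv; lia.
- by [].
by [].
Qed.

Lemma runs_bfs s B : bounded n s -> regs s 0 = n -> arr_set n s 0 = B ->
  (forall x, arrs s 9 x = 0) ->
  runs bfs_prog s 0 (n * (n * 950 + 100) + 60) (fun s' => arr_set n s' 0 = B /\
    [/\ forall k, k < n -> arrs s' 3 k < n,
        {in gtn n &, injective (arrs s' 3)} &
        bfs_tree n (relpre (arrs s' 3) (vadj B)) (arrs s' 4) (arrs s' 5)]).
Proof.
move=> bs r0 a0 a9.
eapply runs_le; [eapply runs_seq; eapply runs_assign|idtac|idtac] => //=.
move=> b1; eapply runs_seq; eapply runs_assign => //=; move=> b2.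
eapply runs_conseq; [apply: (@runs_for n _ _ n_gt0 1 _ _ 0 (n * 950 + 50) (fun h => bfs_state B h 0)) => //|..] => //=.
- by split=> //=; apply: bfs_inv_init.
- move=> h s1 hn b3 r1 r0' _ I1.
  eapply runs_weaken; [apply: (@runs_for n _ _ n_gt0 4 _ _ 0 900 (bfs_state B h)) => //|..] => //=.
  + move=> v s2 vn b4 r4 r02 [agr _] [I2 a2].
    have r1' : regs s2 1 = h by rewrite agr.
    apply: (runs_weaken (runs_bfs_body b4 r02 r1' r4 hn vn (conj I2 a2))) => //.
  + by rewrite muln0.
  move=> s2 _ [[I2 a2] _ _]; split=> //=; exact: bfs_inv_next.
move=> s1 _ [[I1 a1] _ _]; split=> //.
have [et tree] := bfs_inv_tree I1.
rewrite et in I1; split=> //; first exact: (bi_Q I1).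
by move=> i k; rewrite !inE; apply: (bi_inj I1).
- by rewrite muln0.
by rewrite /tick /=; lia.
Qed.

End Programs.

(** * Comparing two elements, and sorting *)

Definition test_heads : prog :=
  Assign 20 (Get 3 (Reg 13)) ;; Assign 21 (Get 3 (Reg 14)) ;; test_adj.

Definition climb (x : nat) : prog :=
  Assign x (Get 4 (Reg x)) ;; flip 7 (Get 3 (Reg x)) ;; flip 8 (Get 3 (Reg x)).

Definition walk_loop : prog :=
  While (iszero (Reg 22)) (If (less (Reg 14) (Reg 13)) (climb 13) (climb 14) ;; test_heads).

Definition copy_basis : prog :=
  For 12 (Put 7 (Reg 12) (Get 0 (Reg 12)) ;; Put 8 (Reg 12) (Get 0 (Reg 12))).

(** Arrays 7 and 8 start as copies of the basis and receive the same toggles; only the last four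
    writes tell them apart. *)
Definition compare_prog : prog :=
  copy_basis ;;
  Assign 13 (Reg 10) ;; Assign 14 (Reg 11) ;; test_heads ;; walk_loop ;;
  Put 7 (Get 3 (Reg 10)) (Const 1) ;; Put 7 (Get 3 (Reg 11)) (Const 0) ;;
  Put 8 (Get 3 (Reg 11)) (Const 1) ;; Put 8 (Get 3 (Reg 10)) (Const 0) ;;
  Compare 22 7 8.

(** Different labels are compared without a query. Within a component, code 2 means that the middle
    element is strictly heavier; ties go to the right half. *)
Definition search_step : prog :=
  Assign 4 (Bin OpDiv (Bin OpAdd (Reg 2) (Reg 3)) (Const 2)) ;;
  Assign 10 (Get 6 (Reg 4)) ;; Assign 11 (Reg 1) ;;
  If (Bin OpEq (Get 5 (Reg 10)) (Get 5 (Reg 11)))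
    (compare_prog ;; Assign 22 (Bin OpEq (Reg 22) (Const 2)))
    (Assign 22 (less (Get 5 (Reg 11)) (Get 5 (Reg 10)))) ;;
  If (Reg 22) (Assign 3 (Reg 4)) (Assign 2 (Bin OpAdd (Reg 4) (Const 1))).

Definition search_loop : prog := While (less (Reg 2) (Reg 3)) search_step.

Definition shift_loop : prog :=
  While (less (Reg 2) (Reg 8))
    (Put 6 (Reg 8) (Get 6 (Bin OpSub (Reg 8) (Const 1))) ;;
     Assign 8 (Bin OpSub (Reg 8) (Const 1))).

(** Array 6 now holds queue positions: round [i] inserts the number [i] itself. *)
Definition sort_prog : prog :=
  For 1 (Assign 2 (Const 0) ;; Assign 3 (Reg 1) ;; search_loop ;;
         Assign 8 (Reg 1) ;; shift_loop ;; Put 6 (Reg 2) (Reg 1)).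

(** * Correctness of the comparison with one query *)

Section Compare.
Variables (R : realType) (n : nat) (M : matroid 'I_n) (w : 'I_n -> R) (x0 : 'I_n).
Notation runs := (runs (indep M) (compare_bases M w)).
Let n_gt0 : 0 < n := n_gt0 x0.
#[local] Hint Resolve n_gt0 : core.

Variables (B : {set 'I_n}) (Q pp cp : nat -> nat).
Let qf k := elt x0 (Q k).
Notation adj := (pos_adj M B qf).
Hypothesis bB : basis M B.
Hypothesis Qlt : forall k, k < n -> Q k < n.
Hypothesis Qinj : {in gtn n &, injective Q}.
Hypothesis tree : bfs_tree n adj pp cp.

Lemma ltn_leqS k : k < n -> k <= n.+1.
Proof. by move=> kn; rewrite ltnW // ltnW. Qed.

Lemma qfE k : k < n -> qf k = Q k :> nat.
Proof. by move=> kn; rewrite /qf eltE ?Qlt. Qed.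

Lemma qf_inj : {in gtn n &, injective qf}.
Proof. by move=> i k iN kN /(congr1 val); rewrite /= !qfE //; apply: Qinj. Qed.

Definition ready (s : state) : Prop :=
  [/\ regs s 0 = n, arr_set n s 0 = B, arrs s 3 = Q, arrs s 4 = pp & arrs s 5 = cp].

Lemma ready_agree xs bs s s' : ready s -> agree xs bs s s' ->
  0 \notin xs -> [&& 3 \notin bs, 4 \notin bs & 5 \notin bs] ->
  arr_set n s' 0 = B -> ready s'.
Proof. by case=> r0 _ a3 a4 a5 [r a] r0' /and3P[b3 b4 b5] a0; split=> //; rewrite ?r ?a. Qed.

Lemma runs_test_heads s u v : bounded n s -> ready s -> regs s 13 = u -> regs s 14 = v ->
  u < n -> v < n ->
  runs test_heads s 0 530 (fun s' => [/\ ready s', agree [:: 20; 21; 22] [:: 0] s s' &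
    regs s' 22 = adj u v]).
Proof.
move=> bs rs r13 r14 un vn; have [r0 a0 a3 a4 a5] := rs.
eapply runs_le; [eapply runs_seq; eapply runs_assign|idtac|idtac] => //=.
  by rewrite r13 a3 ltn_leqS ?Qlt.
rewrite r13 a3 => b1.
eapply runs_seq; eapply runs_assign => //=; first by rewrite r14 a3 ltn_leqS ?Qlt.
rewrite r14 a3 => b2.
eapply runs_frame.
  by apply: (@runs_test_adj _ _ _ x0 _ (qf u) (qf v)); rewrite //= qfE.
move=> s3 b3 ag [/= e0 e22].
have ag' : agree [:: 20; 21; 22] [:: 0] s s3.
  have [/= agr aga] := ag; split=> [y|b].
    rewrite !inE => /norP[y20 /norP[y21 y22]].
    rewrite agr /= ?(negPf y20) ?(negPf y21) //.
    by rewrite !inE !negb_or y22.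
  by rewrite inE => b0; rewrite aga //= !inE !negb_or b0.
split=> //; last by rewrite e22 -a0.
by apply: ready_agree rs ag' _ _ _; rewrite // e0.
- by [].
by [].
Qed.

Lemma runs_climb x s u : bounded n s -> ready s -> regs s x = u -> u < n -> x != 0 ->
  runs (climb x) s 0 300 (fun s' => [/\ ready s', regs s' = regs (set_reg s x (pp u)),
    arr_set n s' 7 = toggle (arr_set n s 7) (qf (pp u)) &
    arr_set n s' 8 = toggle (arr_set n s 8) (qf (pp u))]).
Proof.
move=> bs rs rx un xN; have [r0 a0 a3 a4 a5] := rs.
have pn : pp u < n by apply: leq_ltn_trans (pp_le tree un) un.
eapply runs_le; [eapply runs_seq; eapply runs_assign|idtac|idtac] => //=.
  by rewrite rx a4 ltnW // ltnW.
rewrite rx a4 => b1.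
eapply runs_seq; eapply runs_flip with (i := qf (pp u)) => //=.
  by rewrite eqxx a3 qfE.
move=> s2 b2 e2 f2 t2 _.
eapply runs_flip with (i := qf (pp u)) => //=.
  by rewrite e2 /= eqxx f2 //= a3 qfE.
move=> s3 b3 e3 f3 t3; split.
- split; rewrite ?e3 ?e2 ?f3 ?f2 //= 1?eq_sym ?(negPf xN) //.
  by rewrite /arr_set f3 // f2.
- by rewrite e3 e2.
- by rewrite /arr_set f3 //; exact: t2.
by rewrite t3 /arr_set f2.
- by [].
by [].
Qed.

Definition walked (u v : nat) (s s' : state) : Prop :=
  ready s' /\ exists p, [/\ walk adj pp u v p,
    arr_set n s' 7 = toggles (arr_set n s 7) (map qf p) &
    arr_set n s' 8 = toggles (arr_set n s 8) (map qf p)].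

(** Each climb strictly lowers [u + v], so the number of rounds is linear. *)
Lemma runs_walk_loop k s u v : u + v < k -> bounded n s -> ready s ->
  regs s 13 = u -> regs s 14 = v -> u < n -> v < n -> u != v -> cp u = cp v ->
  regs s 22 = adj u v ->
  runs walk_loop s 0 (k * 1000) (walked u v s).
Proof.
elim: k s u v => // k IH s u v; rewrite ltnS => le bs rs r13 r14 un vn uv ec r22.
have [auv|nauv] := boolP (adj u v).
  eapply runs_le; [eapply runs_while_stop|idtac|idtac] => //=; first by rewrite r22 auv.
  split=> //; exists [::]; split=> //; exact: WalkStop.
pose next s1 := exists u' v', [/\ [/\ u' + v' < k, u' < n, v' < n, u' != v' & cp u' = cp v'],
  [/\ ready s1, regs s1 13 = u' & regs s1 14 = v'] &
  forall s2, walked u' v' s1 s2 -> walked u v s s2].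
(* Keeps the two ends distinct: the new end is adjacent to the old one, the opposite end is not. *)
have apart i j l : adj i j -> ~~ adj i l -> j != l by move=> aij; apply: contraNneq => <-.
eapply runs_le; [eapply runs_while_step|idtac|idtac] => //=; first by rewrite r22 (negPf nauv).
  eapply runs_seq; eapply (@runs_weaken n _ _ _ _ 0 400 0 400 next) => //.
    eapply runs_le; [eapply runs_if|idtac|idtac] => //=.
    + rewrite r13 r14 addn1 eqb0 negbK => vu.
      have lt := pp_lt tree un vu ec.
      eapply runs_conseq; first exact: (@runs_climb 13 s u).
      move=> s1 b1 [rs1 e1 t7 t8]; exists (pp u), v; split.
      * split=> //; [lia|lia| |by rewrite (cp_pp tree)].
        by apply: apart nauv; rewrite adjC; apply: (pp_adj tree).
      * by split=> //; rewrite e1.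
      move=> s2 [rs2 [p [wk p7 p8]]]; split=> //; exists (pp u :: p).
      by split; [exact: WalkLeft | rewrite p7 t7 | rewrite p8 t8].
    + rewrite r13 r14 addn1 => /eqP; rewrite eqb0 -leqNgt => vu.
      have {}vu : u < v by rewrite ltn_neqAle uv.
      have lt := pp_lt tree vn vu (esym ec).
      eapply runs_conseq; first exact: (@runs_climb 14 s v).
      move=> s1 b1 [rs1 e1 t7 t8]; exists u, (pp v); split.
      * split=> //; [lia|lia| |by rewrite (cp_pp tree)].
        by rewrite eq_sym; apply: (apart v); rewrite adjC //; apply: (pp_adj tree).
      * by split=> //; rewrite e1.
      move=> s2 [rs2 [p [wk p7 p8]]]; split=> //; exists (pp v :: p).
      by split; [exact: WalkRight | rewrite p7 t7 | rewrite p8 t8].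
    + by [].
    by [].
  move=> s1 b1 [u' [v' [[lt un' vn' uv' ec'] [rs1 r13' r14'] H]]] _.
  eapply runs_conseq; first exact: (runs_test_heads b1 rs1 r13' r14' un' vn').
  move=> s2 b2 [rs2 ag e22] _.
  have [agr aga] := ag.
  eapply runs_conseq.
    by apply: (IH s2 u' v') => //; rewrite ?agr.
  move=> s3 b3 [rs3 [p [wk p7 p8]]]; apply: H; split=> //; exists p; split=> //.
    by rewrite p7 (agree_arr_set n ag).
  by rewrite p8 (agree_arr_set n ag).
- by [].
rewrite /tick /=; lia.
Qed.

Lemma runs_copy_basis s : bounded n s -> ready s ->
  runs copy_basis s 0 (n * 100 + 50) (fun s' => [/\ ready s', arr_set n s' 7 = B &
    arr_set n s' 8 = B]).
Proof.
move=> bs rs; have [r0 a0 a3 a4 a5] := rs.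
pose Inv k s' := forall i, i < k -> arrs s' 7 i = arrs s 0 i /\ arrs s' 8 i = arrs s 0 i.
eapply runs_weaken; [apply: (@runs_for n _ _ n_gt0 12 _ s 0 50 Inv) => //|..] => //=.
- move=> i s1 lt b1 ri rn [_ ag] I1.
  eapply runs_le; [eapply runs_seq; eapply runs_put|idtac|idtac] => //=.
    by case: b1.
  rewrite ri => b2; eapply runs_put => //=; first by case: b1.
  rewrite ri (ag 0) // => j /=; rewrite ltnS leq_eqVlt.
  by case: eqP => [->|_] //=; apply: I1.
  by [].
  by [].
- by rewrite muln0.
move=> s' b' [I r0' ag]; have ag0 : arr_set n s' 0 = B by rewrite (agree_arr_set n ag).
split; first exact: ready_agree rs ag _ _ _.
  by rewrite -a0; apply/setP=> i; rewrite !inE; have [-> _] := I i (ltn_ord i).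
by rewrite -a0; apply/setP=> i; rewrite !inE; have [_ ->] := I i (ltn_ord i).
Qed.

Definition weight_order (a b : nat) : comparison :=
  if (w (qf a) < w (qf b))%R then Lt else if w (qf a) == w (qf b) then Eq else Gt.

Lemma runs_compare_prog s a b : bounded n s -> ready s -> regs s 10 = a -> regs s 11 = b ->
  a < n -> b < n -> a != b -> cp a = cp b ->
  runs compare_prog s 1 (n * 2100 + 1000)
    (fun s' => ready s' /\ regs s' 22 = comparison_code (weight_order a b)).
Proof.
move=> bs rs r10 r11 an bn ab ec.
eapply runs_le; [eapply runs_seq; eapply runs_frame; first exact: runs_copy_basis|idtac|idtac] => //=.
move=> s1 b1 ag1 [rs1 s17 s18] _.
have r10' : regs s1 10 = a by rewrite (proj1 ag1).
have r11' : regs s1 11 = b by rewrite (proj1 ag1).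
eapply runs_seq; eapply runs_assign => //=; first by rewrite r10' ltnW // ltnW.
rewrite r10' => b2.
eapply runs_seq; eapply runs_assign => //=; first by rewrite r11' ltnW // ltnW.
rewrite r11' => b3.
have rs3 : ready (set_reg (set_reg s1 13 a) 14 b) by [].
eapply runs_seq; eapply runs_conseq; first exact: (runs_test_heads b3 rs3 _ _ an bn).
move=> s4 b4 [rs4 ag4 r22] _; have [/= agr4 _] := ag4.
eapply runs_seq; eapply runs_frame.
  (* Since [a + b < n + n], the walk costs at most 2000 per element; copying the basis accounts for
     the other 100 in 2100. *)
  apply: (@runs_walk_loop (n + n) s4 a b) => //; rewrite ?agr4 //; lia.
move=> s5 b5 ag5 [rs5 [p [wk p7 p8]]] _; have [/= agr5 _] := ag5.
have r10_5 : regs s5 10 = a by rewrite agr5 // agr4.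
have r11_5 : regs s5 11 = b by rewrite agr5 // agr4.
have [r0 a0 a3 a4 a5] := rs5.
set X := toggles B (map qf p).
have {}p7 : arr_set n s5 7 = X by rewrite p7 (agree_arr_set n ag4) // -[X]/(toggles B _) -s17.
have {}p8 : arr_set n s5 8 = X by rewrite p8 (agree_arr_set n ag4) // -[X]/(toggles B _) -s18.
have qab : qf a != qf b by apply: contraNneq ab => /qf_inj ->.
eapply runs_seq; eapply runs_put => //= b6; rewrite r10_5 a3 -qfE // in b6 *.
eapply runs_seq; eapply runs_put => //= b7; rewrite r11_5 a3 -qfE // in b7 *.
eapply runs_seq; eapply runs_put => //= b8; rewrite r11_5 a3 -qfE // in b8 *.
eapply runs_seq; eapply runs_put => //= b9; rewrite r10_5 a3 -qfE // in b9 *.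
set s9 := set_arr _ 8 (qf a) 0.
have e7 : arr_set n s9 7 = put_swap X (qf a) (qf b).
  apply/setP=> i; rewrite in_put_swap -p7 !inE /= !val_eqE.
  have [->|ib] := eqVneq i (qf b); first by rewrite eq_sym (negPf qab).
  by have [->|ia] := eqVneq i (qf a).
have e8 : arr_set n s9 8 = put_swap X (qf b) (qf a).
  apply/setP=> i; rewrite in_put_swap -p8 !inE /= !val_eqE.
  have [->|ia] := eqVneq i (qf a); first by rewrite (negPf qab).
  by have [->|ib] := eqVneq i (qf b).
(* Both arrays hold bases, so the query is allowed. *)
have [ba bb] := walk_bases bB qf_inj tree wk an bn ec.
eapply runs_compare => //.
  by rewrite e7 e8 compare_put_swap.
- by [].
rewrite /tick /=; lia.
Qed.

(** * Binary insertion sort by component label, then by weight *)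

Definition le_pos (a b : nat) : bool :=
  (cp a < cp b) || (cp a == cp b) && (w (qf a) <= w (qf b))%R.

Lemma le_pos_trans : transitive le_pos.
Proof.
move=> b a c /orP[ab|/andP[/eqP ab wab]] /orP[bc|/andP[/eqP bc wbc]]; apply/orP.
- by left; apply: ltn_trans ab bc.
- by left; rewrite -bc.
- by left; rewrite ab.
by right; rewrite ab bc eqxx (le_trans wab wbc).
Qed.

Lemma le_pos_total : total le_pos.
Proof.
by move=> a b; rewrite /le_pos; case: (ltngtP (cp a) (cp b)) => //= _; apply: le_total.
Qed.

Record ordered (i : nat) (f : nat -> nat) : Prop := Ordered {
  ordered_lt : forall k, k < i -> f k < i;
  ordered_inj : forall j k, j < i -> k < i -> f j = f k -> j = k;
  ordered_sorted : forall j k, j <= k -> k < i -> le_pos (f j) (f k) }.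

Definition splits (i lo hi : nat) (f : nat -> nat) : Prop :=
  (forall k, k < lo -> le_pos (f k) i) /\
  (forall k, hi <= k -> k < i -> le_pos i (f k)).

Lemma runs_search_step s i lo hi : bounded n s -> ready s -> regs s 1 = i -> i < n ->
  ordered i (arrs s 6) -> regs s 2 = lo -> regs s 3 = hi -> lo < hi -> hi <= i ->
  splits i lo hi (arrs s 6) ->
  runs search_step s 1 (n * 2100 + 1900) (fun s' => ready s' /\
    exists lo' hi', [/\ regs s' 2 = lo', regs s' 3 = hi', lo' <= hi' /\ hi' <= i,
      (hi' - lo').*2 <= hi - lo & splits i lo' hi' (arrs s 6)]).
Proof.
move=> bs rs r1 lt_in or r2 r3 lh hi_i [sl sr].
have [r0 a0 a3 a4 a5] := rs.
pose mid := (lo + hi) %/ 2; set a := arrs s 6 mid.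
have lo_mid : lo <= mid by rewrite /mid; lia.
have mid_hi : mid < hi by rewrite /mid; lia.
have mid_i : mid < i by lia.
have ai : a < i by apply: (ordered_lt or).
eapply runs_le; [eapply runs_seq; eapply runs_assign|idtac|idtac] => //=.
  by rewrite r2 r3; lia.
rewrite r2 r3 -/mid => b1.
eapply runs_seq; eapply runs_assign => //=; first by rewrite -/a ltn_leqS // (ltn_trans ai).
rewrite -/a => b2.
eapply runs_seq; eapply runs_assign => //=; first by rewrite r1 ltn_leqS.
rewrite r1; set s3 := set_reg _ 11 i => b3.
have rs3 : ready s3 by [].
pose post s' := [/\ ready s', agree [:: 12; 13; 14; 20; 21; 22] [:: 0; 7; 8] s3 s' &
   regs s' 22 = ~~ le_pos a i].
have an : a < n by apply: ltn_trans ai lt_in.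
eapply runs_seq; eapply (@runs_weaken n _ _ _ _ 1 (n * 2100 + 1400) 1 (n * 2100 + 1400) post) => //.
  eapply runs_le; [eapply runs_if|idtac|idtac] => //=.
  - rewrite a5 eqb0 negbK => /eqP ec.
    eapply runs_seq; eapply runs_frame.
      by apply: (@runs_compare_prog s3 a i) => //; rewrite ltn_eqF.
    move=> s4 b4 ag [rs4 r22] _.
    eapply runs_assign => //=; first by case: (_ == _).
    split; first by case: rs4.
      have [agr aga] := ag; split=> [y yN|b bN].
        have -> : regs (set_reg s4 22 (regs s4 22 == 2)) y = regs s4 y.
          by rewrite /=; case: eqP yN => // ->.
        apply: agr; apply: contra yN.
        by rewrite /= !inE; do !case: (y == _) => //=.
      apply: aga; apply: contra bN.
      by rewrite /= !inE; do !case: (b == _) => //=.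
    rewrite /= r22 /le_pos ec ltnn eqxx /= /weight_order.
    by case: ltgtP.
  - rewrite a5 => /eqP; rewrite eqb0 => ec.
    eapply runs_assign => //=; first by apply: leq_trans (leq_b1 _) _.
    split=> //.
      by split=> // y yN; rewrite [LHS]/=; case: eqP yN => // ->.
    by rewrite /= a5 /le_pos (negPf ec) orbF addn1 -leqNgt; congr nat_of_bool; move: ec; lia.
  - by [].
  by rewrite /tick /=; lia.
move=> s4 b4 [rs4 [agr aga] r22] _.
have r2' : regs s4 2 = lo by rewrite agr.
have r3' : regs s4 3 = hi by rewrite agr.
have r4' : regs s4 4 = mid by rewrite agr.
eapply runs_if => //=.
- rewrite r22 eqb0 negbK => nle; have le_ia : le_pos i a.
    by have := le_pos_total a i; rewrite (negPf nle).
  eapply runs_assign => //=; first by rewrite r4'; lia.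
  rewrite r4'; split; first by case: rs4.
  exists lo, mid; split=> //=; first by split=> //; lia.
    by rewrite /mid; lia.
  split=> // k mk ki; apply: le_pos_trans le_ia _; exact: (ordered_sorted or).
- rewrite r22 => /eqP; rewrite eqb0 negbK => le_ai.
  eapply runs_assign => //=; first by rewrite r4'; lia.
  rewrite r4' addn1; split; first by case: rs4.
  exists mid.+1, hi; split=> //=; first by rewrite /mid; lia.
  split=> // k; rewrite ltnS => km; apply: le_pos_trans le_ai; exact: (ordered_sorted or).
- by [].
by rewrite /tick /=; lia.
Qed.

(** Every round at least halves [hi - lo], so [k] queries suffice for an interval shorter than
    [2 ^ k]. *)
Lemma runs_search_loop k s i lo hi : bounded n s -> ready s -> regs s 1 = i -> i < n ->
  ordered i (arrs s 6) -> regs s 2 = lo -> regs s 3 = hi -> lo <= hi -> hi <= i ->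
  splits i lo hi (arrs s 6) -> hi - lo < 2 ^ k ->
  runs search_loop s k (k * (n * 2100 + 2000) + 50) (fun s' => ready s' /\
    exists lo', [/\ regs s' 2 = lo', lo' <= i & splits i lo' lo' (arrs s 6)]).
Proof.
elim: k s lo hi => [|k IH] s lo hi bs rs r1 lt_in or r2 r3 lh hi_i sp lt.
  have e : hi = lo by lia.
  eapply runs_le; [eapply runs_while_stop|idtac|idtac] => //=.
    by rewrite r2 r3 e; lia.
  by rewrite e in hi_i sp; split=> //; exists lo.
move: lh; rewrite leq_eqVlt => /predU1P[e|lh].
  eapply runs_le; [eapply runs_while_stop|idtac|idtac] => //=.
  - by rewrite r2 r3 e; lia.
  - by rewrite -e in hi_i sp; split=> //; exists lo.
  by rewrite /tick /=; lia.
eapply runs_le; [eapply runs_while_step|idtac|idtac] => //=.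
- by rewrite r2 r3; lia.
- eapply runs_frame; first exact: (runs_search_step bs rs r1 lt_in or r2 r3 lh hi_i sp).
  move=> s1 b1 [/= agr aga] [rs1 [lo' [hi' [r2' r3' [lh' hi_i'] half sp']]]] _.
  have e6 : arrs s1 6 = arrs s 6 by rewrite aga.
  eapply runs_conseq.
    apply: (IH s1 lo' hi') => //; rewrite ?e6 ?agr //.
    by move: lt half; rewrite expnS; lia.
  by rewrite e6.
- by rewrite add1n.
by rewrite /tick /=; lia.
Qed.

(** The shift proceeds from the top down, so each entry is copied before it is overwritten. *)
Lemma runs_shift_loop k s lo j : bounded n s -> regs s 2 = lo -> regs s 8 = j -> j = lo + k ->
  runs shift_loop s 0 (k * 100 + 50) (fun s' => forall m, arrs s' 6 m =
    if (lo < m) && (m <= j) then arrs s 6 m.-1 else arrs s 6 m).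
Proof.
elim: k s j => [|k IH] s j bs r2 r8 ej.
  eapply runs_le; [eapply runs_while_stop|idtac|idtac] => //=.
    by rewrite r2 r8; lia.
  by move=> m; rewrite ej addn0; case: ltnP.
have jb : j <= n.+1 by rewrite -r8; case: bs.
eapply runs_le; [eapply runs_while_step|idtac|idtac] => //=.
- by rewrite r2 r8; lia.
- eapply runs_seq; eapply runs_put => //=; first by case: bs.
  rewrite r8 => b1; eapply runs_assign => //=; first by rewrite r8; lia.
  rewrite r8 => b2.
  eapply runs_conseq.
    by apply: (IH _ (j - 1)) => //; lia.
  move=> s' b' H m; rewrite H /=; case: (eqVneq m j) => [->|mj].
    have -> : (lo < j) && (j <= j - 1) = false by lia.
    have -> : (lo < j) && (j <= j) by lia.
    by rewrite subn1.
  case: (eqVneq m.-1 j) => [ej'|_].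
    have -> : (m <= j) = false by lia.
    have -> : (m <= j - 1) = false by lia.
    by rewrite !andbF.
  by have -> : (m <= j - 1) = (m <= j) by lia.
- by [].
by rewrite /tick /=; lia.
Qed.

Lemma ordered_insert i lo f g : ordered i f -> splits i lo lo f -> lo <= i ->
  (forall k, k <= i -> g k = if k == lo then i else if lo < k then f k.-1 else f k) ->
  ordered i.+1 g.
Proof.
move=> or [sl sr] lo_i gE; split.
- move=> k ki; rewrite gE //; case: eqP => // kl; case: ifP => lk; apply: leqW; apply: (ordered_lt or); lia.
- have f_neq k : k < i -> f k != i by move=> ki; rewrite ltn_eqF // (ordered_lt or).
  move=> j k; rewrite !ltnS => ji ki; rewrite !gE //.
  have F a b := ordered_inj or (j := a) (k := b).
  case: (eqVneq j lo) => jl; case: (eqVneq k lo) => kl; first by rewrite jl kl.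
  + by case: ifP => lk /esym /eqP; rewrite (negPf (f_neq _ _)) //; lia.
  + by case: ifP => lk /eqP; rewrite (negPf (f_neq _ _)) //; lia.
  by case: ifP => lj; case: ifP => lk /F; lia.
have le_refl a : le_pos a a by have := le_pos_total a a; rewrite orbb.
have S a b := ordered_sorted or (j := a) (k := b).
move=> j k jk ki; rewrite !gE //; last by lia.
case: (eqVneq j lo) => jl; case: (eqVneq k lo) => kl //.
- have -> : lo < k by lia.
  by apply: sr; lia.
- have -> : (lo < j) = false by lia.
  by apply: sl; lia.
by case: ifP => lj; case: ifP => lk; apply: S; lia.
Qed.

Lemma runs_sort s : bounded n s -> ready s ->
  runs sort_prog s (n * (trunc_log 2 n).+1)
    (n * ((trunc_log 2 n).+1 * (n * 2100 + 2000) + n * 100 + 300) + 50)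
    (fun s' => ready s' /\ ordered n (arrs s' 6)).
Proof.
move=> bs rs; set K := (trunc_log 2 n).+1.
have [r0 a0 a3 a4 a5] := rs.
pose Inv i s' := ready s' /\ ordered i (arrs s' 6).
eapply runs_weaken; [apply: (@runs_for n _ _ n_gt0 1 _ s K (K * (n * 2100 + 2000) + n * 100 + 250) Inv) => //|..] => //=.
- move=> i s1 lt b1 r1 r01 _ [rs1 or1].
  eapply runs_le; [eapply runs_seq; eapply runs_assign|idtac|idtac] => //=.
  move=> b2; eapply runs_seq; eapply runs_assign => //=; first by rewrite r1 ltn_leqS.
  rewrite r1; set s3 := set_reg _ 3 i => b3.
  eapply runs_seq; eapply runs_frame.
    apply: (@runs_search_loop K s3 i 0 i) => //.
      by split=> // k; lia.
    (* [i < n < 2 ^ K], so [K] queries insert one element. *)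
    by rewrite subn0; apply: ltn_trans lt _; apply: trunc_log_ltn.
  move=> s4 b4 [/= agr aga] [rs4 [lo [r2 lo_i sp]]] _.
  have r14 : regs s4 1 = i by rewrite agr.
  have e6 : arrs s4 6 = arrs s1 6 by rewrite aga.
  eapply runs_seq; eapply runs_assign => //=; first by rewrite r14 ltn_leqS.
  rewrite r14 => b5.
  eapply runs_seq; eapply runs_frame.
    have H : runs shift_loop (set_reg s4 8 i) 0 (i * 100 + 50) (fun s' => forall m,
        arrs s' 6 m = if (lo < m) && (m <= i) then arrs s4 6 m.-1 else arrs s4 6 m).
      apply: runs_le (_ : runs _ _ 0 ((i - lo) * 100 + 50) _) _ _ => //; last by lia.
      by apply: runs_shift_loop => //=; lia.
    exact: H.
  move=> s6 b6 [/= agr6 aga6] H _.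
  have r16 : regs s6 1 = i by rewrite agr6.
  have r26 : regs s6 2 = lo by rewrite agr6.
  eapply runs_put => //=; first by rewrite r16 ltn_leqS.
  rewrite r16 r26; have [x1 x2 x3 x4 x5] := rs4; split.
    split=> //=; rewrite ?agr6 ?aga6 //.
    by rewrite -x2; apply/setP=> m; rewrite !inE /= aga6.
  apply: ordered_insert or1 sp lo_i _ => k ki /=; case: eqVneq => // kl.
  by rewrite H /= e6 ki andbT.
  by rewrite !addn0 add0n.
  rewrite /tick /=.
  have : i * 100 <= n * 100 by rewrite leq_mul2r; lia.
  lia.
- by lia.
by move=> s' _ [].
Qed.

End Compare.

(** * The algorithm *)

Definition enumerate_prog : prog := For 1 (Put 6 (Reg 1) (Reg 1)).

(** Turns sorted queue positions into elements, in place, and empties array 0 for the second greedy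
    run. *)
Definition reset_prog : prog :=
  For 1 (Put 6 (Reg 1) (Get 3 (Get 6 (Reg 1))) ;; Put 0 (Reg 1) (Const 0)).

(** The first greedy run, in arbitrary order, only supplies the fixed basis and asks no comparison.
    The test on register 0 isolates the empty ground set. *)
Definition main_prog : prog :=
  If (Reg 0)
    (enumerate_prog ;; greedy_prog ;; bfs_prog ;; sort_prog ;; reset_prog ;; greedy_prog)
    Skip.

Section Main.
Variables (R : realType) (n : nat) (M : matroid 'I_n) (w : 'I_n -> R) (x0 : 'I_n).
Notation runs := (runs (indep M) (compare_bases M w)).
Let n_gt0 : 0 < n := n_gt0 x0.
#[local] Hint Resolve n_gt0 : core.

Lemma runs_enumerate s : bounded n s -> regs s 0 = n ->
  runs enumerate_prog s 0 (n * 100 + 50) (fun s' => array_is x0 s' 6 (enum 'I_n)).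
Proof.
move=> bs r0; pose Inv k s' := forall i, i < k -> arrs s' 6 i = i.
eapply runs_weaken; [apply: (@runs_for n _ _ n_gt0 1 _ s 0 50 Inv) => //|..] => //=.
- move=> i s1 lt b1 ri rn _ I1.
  eapply runs_le; [eapply runs_put|idtac|idtac] => //=; first by rewrite ri ltn_leqS.
  rewrite ri => k /=; rewrite ltnS leq_eqVlt.
  by case: eqP => //= _; apply: I1.
- by rewrite muln0.
move=> s' _ [I _ _] k; rewrite size_enum_ord => kn.
by rewrite I // nth_enum_ord.
Qed.

Lemma runs_reset s Q l : bounded n s -> regs s 0 = n -> arrs s 3 = Q ->
  (forall k, k < n -> Q k < n) -> (forall k, k < n -> arrs s 6 k < n) ->
  l = mkseq (fun k => elt x0 (Q (arrs s 6 k))) n ->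
  runs reset_prog s 0 (n * 100 + 50)
    (fun s' => array_is x0 s' 6 l /\ arr_set n s' 0 = set0).
Proof.
move=> bs r0 a3 Qlt flt ->.
pose Inv k s' := (forall i, arrs s' 6 i = if i < k then Q (arrs s 6 i) else arrs s 6 i) /\
  (forall i, i < k -> arrs s' 0 i = 0).
eapply runs_weaken; [apply: (@runs_for n _ _ n_gt0 1 _ s 0 50 Inv) => //|..] => //=.
- move=> i s1 lt b1 ri rn [_ aga] [I1 I2].
  eapply runs_le; [eapply runs_seq; eapply runs_put|idtac|idtac] => //=; first by case: b1.
  rewrite ri aga // a3 I1 ltnn => b2.
  eapply runs_put => //=; rewrite ri; split=> [k|k] /=.
    by rewrite ltnS leq_eqVlt; case: eqP => [->//|_] /=; apply: I1.
  by rewrite ltnS leq_eqVlt; case: eqP => //= _; apply: I2.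
  by [].
  by [].
- by rewrite muln0.
move=> s' _ [[I1 I2] _ _]; split.
  move=> k; rewrite size_mkseq => kn.
  by rewrite nth_mkseq // I1 kn eltE // Qlt // flt.
by apply/setP=> i; rewrite !inE I2.
Qed.

Lemma runs_main : runs main_prog (init_state n) (n * (trunc_log 2 n).+1)
  (7 * 1000 * (n * n * (trunc_log 2 n).+1))
  (fun s' => min_weight_basis M w (arr_set n s' 0)).
Proof.
have bs : bounded n (init_state n) by split=> //= x; case: ifP.
have fullE (l : seq 'I_n) : uniq l -> size l = n -> forall x, x \in l.
  move=> ul sl x; have sub : {subset l <= enum 'I_n} by move=> y _; rewrite mem_enum.
  by have [|_ ->] := uniq_min_size ul sub; rewrite ?mem_enum // size_enum_ord sl.
set K := (trunc_log 2 n).+1.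
eapply runs_le; [eapply runs_if|idtac|idtac] => //=.
move=> _.
eapply runs_seq; eapply runs_frame; first exact: (runs_enumerate bs).
move=> s1 b1 [/= agr1 aga1] A1 _.
have uE := enum_uniq 'I_n; have sE := size_enum_ord n.
have fE := fullE _ uE sE.
eapply runs_seq; eapply runs_frame; first apply: (runs_greedy _ _ b1 _ sE A1).
- by rewrite agr1.
- by apply/setP=> i; rewrite !inE aga1.
move=> s2 b2 [/= agr2 aga2]; set B := greedy M _ => a2 _.
have bB : basis M B by apply: greedy_basis.
eapply runs_seq; eapply runs_frame; first apply: (runs_bfs _ _ x0 b2 _ a2).
- by rewrite agr2 // agr1.
- by move=> x; rewrite aga2 // aga1.
move=> s3 b3 [/= agr3 aga3] [a3 [Qlt Qinj tree]] _.
set Q := arrs s3 3 in Qlt Qinj tree; set pp := arrs s3 4 in tree; set cp := arrs s3 5 in tree.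
have r3 : regs s3 0 = n by rewrite agr3 // agr2 // agr1.
have rs3 : ready B Q pp cp s3 by [].
eapply runs_seq; eapply runs_frame; first exact: (runs_sort w bB Qlt Qinj tree b3 rs3).
move=> s4 b4 [/= agr4 aga4] [[r4 a4 Q4 pp4 cp4] or] _.
set f := arrs s4 6 in or.
pose qf k := elt x0 (Q k); pose l := mkseq (fun k => qf (f k)) n.
eapply runs_seq; eapply runs_frame.
  exact: (runs_reset (l := l) b4 r4 Q4 Qlt (ordered_lt or)).
move=> s5 b5 [/= agr5 aga5] [A5 a5] _.
have qf_inj' : {in gtn n &, injective qf} := qf_inj Qlt Qinj.
have f_lt k : k < n -> f k < n by apply: (ordered_lt or).
have l_inj : {in gtn n &, injective (fun k => qf (f k))}.
  by move=> i k; rewrite !inE => iN kN e; apply: (ordered_inj or) => //; apply: qf_inj' e; rewrite inE /= f_lt.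
have ul : uniq l.
  rewrite map_inj_in_uniq ?iota_uniq // => i k.
  by rewrite !mem_iota => /andP[_ iN] /andP[_ kN]; apply: l_inj.
have sl : size l = n by rewrite size_mkseq.
have fl := fullE l ul sl.
eapply runs_conseq; first apply: (runs_greedy _ _ b5 _ sl A5 a5).
- by rewrite agr5.
move=> s6 _ ->.
pose ql := mkseq qf n.
have uql : uniq ql.
  rewrite map_inj_in_uniq ?iota_uniq // => i k.
  by rewrite !mem_iota => /andP[_ iN] /andP[_ kN]; apply: qf_inj'.
have sql : size ql = n by rewrite size_mkseq.
(* The component label of an element, read at its queue position. *)
pose lab x := cp (index x ql).
have labE k : k < n -> lab (qf k) = cp k.
  by move=> kn; rewrite /lab -{1}(nth_mkseq x0 qf kn) index_uniq ?sql.
have posE x : exists2 k, k < n & x = qf k.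
  have := fullE ql uql sql x; case/mapP=> k; rewrite mem_iota => /andP[_ kn] ->.
  by exists k.
apply: (greedy_min (lab := lab) bB) => // [x y|x y].
  have [i iN ->] := posE x; have [k kN ->] := posE y; rewrite !labE //.
  exact: (adj_cp tree).
have [i iN ex] : exists2 i, i < n & x = qf (f i).
  by have := fl x; case/mapP=> k; rewrite mem_iota => /andP[_ kn] ->; exists k.
have [j jN ey] : exists2 j, j < n & y = qf (f j).
  by have := fl y; case/mapP=> k; rewrite mem_iota => /andP[_ kn] ->; exists k.
have ixE k : k < n -> index (qf (f k)) l = k.
  by move=> kn; rewrite -(nth_mkseq x0 (fun k => qf (f k)) kn) index_uniq ?sl.
rewrite ex ey !ixE // !labE ?f_lt // => ji ec.
by have := ordered_sorted or (ltnW ji) iN; rewrite /le_pos ec ltnn eqxx.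
- by move=> n0; eapply runs_skip => //; exfalso; move: n_gt0; rewrite n0.
- by rewrite -/K; lia.
(* Every term of the total is absorbed into a multiple of [n * n * K]; the coefficients add up to
   less than 7000. *)
rewrite /tick /= -/K; have K_gt0 : 0 < K by [].
have h1 : n * n <= n * n * K by rewrite leq_pmulr.
have h2 : n <= n * n by rewrite leq_pmulr.
have h3 : n * K <= n * n * K by rewrite leq_mul2r h2 orbT.
have h0 : 0 < n by [].
nia.
Qed.

End Main.

Theorem mainTheorem8 (R : realType) :
  exists (p : prog) (Q T : nat -> nat),
    [/\ bigO Q (fun n => n * trunc_log 2 n),
        soft_bigO T (fun n => n ^ 2)
      & forall (n : nat) (M : matroid 'I_n) (w : 'I_n -> R),
          exists (S : {set 'I_n}) (q t : nat),
            [/\ outputs p M w S q t, q <= Q n, t <= T n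
              & min_weight_basis M w S] ].
Proof.
(* The factor [word n] converts words into time units; the 10 covers the run on the empty ground
   set, which takes 3 units. *)
exists main_prog, (fun n => n * (trunc_log 2 n).+1),
  (fun n => (7 * 1000 * (n * n * (trunc_log 2 n).+1) + 10) * word n).
have log_gt0 n : 2 <= n -> 0 < trunc_log 2 n by move=> n2; rewrite trunc_log_gt0.
split.
- exists 2, 2 => n n2; have := log_gt0 n n2; nia.
(* The exponent is 2: one logarithm comes from binary search, the other from the word length. *)
- exists 2, (50 * 1000), 2 => n n2; have l_gt0 := log_gt0 n n2.
  have wE : word n <= 3 * trunc_log 2 n.
    have : trunc_log 2 n.+2 <= (trunc_log 2 n).+1.
      rewrite -trunc_log2_double; last by lia.
      by apply: leq_trunc_log; lia.
    by rewrite /word; lia.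
  apply: leq_trans (leq_mul (leqnn _) wE) _.
  move: (trunc_log 2 n) l_gt0 => l l_gt0 {wE}.
  have h1 : n * n * l.+1 <= 2 * (n * n * l) by nia.
  have h2 : 1 <= n * n * l by nia.
  have -> : n ^ 2 * l ^ 2 = (n * n * l) * l by rewrite -!mulnn; lia.
  move: (n * n * l) (n * n * l.+1) h1 h2 => x y h1 h2; nia.
move=> n M w; case: n M w => [|m] M w.
  exists set0, 0, 3; split=> //.
  - exists (init_state 0); last by apply/setP; case.
    apply: (@ExecIf _ _ _ _ _ _ _ _ 0 1); exact: ExecSkip.
  - split; last by move=> T _; rewrite (_ : T = set0) //; apply/setP; case.
    apply/maxsetP; split; first exact: indep0.
    by move=> T _ _; apply/setP; case.
have [s [q [t [ex lq lt _ min]]]] := runs_main M w ord0.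
exists (arr_set m.+1 s 0), q, t; split=> //; first by exists s.
by apply: leq_trans lt _; rewrite leq_mul2r leq_addr orbT.
Qed.
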